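(* Each of the following eighteen permutation statistics, defined for $\pi=\pi_1\cdots\pi_n\in\mathfrak S_n$, is Mahonian: $\mathrm{mak}'(\pi)=\mathrm{mak}(\pi)+(1-n)\mathrm{des}(\pi)+\pi_n+n(n-3)/2$; $\mathrm{mad}'(\pi)=\mathrm{mad}(\pi)+2\pi_n-n-1$; $\mathrm{makl}'(\pi)=\mathrm{makl}(\pi)-n\,\mathrm{des}(\pi)+n(n-1)/2$; $\mathrm{madl}'(\pi)=\mathrm{madl}(\pi)-\mathrm{des}(\pi)+\pi_n-1$; $\mathrm{fz3}(\pi)=\mathrm{ebot}(\pi)+\mathrm{edif}(\pi)-\mathrm{exc}(\pi)-\mathrm{ine}(\pi)$; $\mathrm{fz4}(\pi)=2\,\mathrm{edif}(\pi)-\mathrm{exc}(\pi)-\mathrm{ine}(\pi)$; $\mathrm{inv}'(\pi)=\mathrm{inv}(\pi)+2\pi_n-1-n$; $\mathrm{den}'(\pi)=\mathrm{den}(\pi)+(1-n)\mathrm{exc}(\pi)+\pi_n+n(n-3)/2$; $\mathrm{fz3}'(\pi)=\mathrm{fz3}(\pi)-n\,\mathrm{exc}(\pi)+n(n-1)/2$; $\mathrm{fz4}'(\pi)=\mathrm{fz4}(\pi)-\mathrm{exc}(\pi)+\pi_n-1$; $\mathrm{yzl1}(\pi)=\mathrm{vbot}(\pi)+\mathrm{vnest}(\pi)$; $\mathrm{yzl2}(\pi)=\mathrm{vedif}(\pi)+\mathrm{vnest}(\pi)$; $\mathrm{yzl3}(\pi)=\mathrm{vbot}(\pi)+\mathrm{vedif}(\pi)-(n-1-\mathrm{exc}(\pi))-\mathrm{vnest}(\pi)$;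 $\mathrm{yzl4}(\pi)=2\,\mathrm{vedif}(\pi)-(n-1-\mathrm{exc}(\pi))-\mathrm{vnest}(\pi)$; $\mathrm{yzl1}'(\pi)=\mathrm{yzl1}(\pi)+(n-1)\mathrm{exc}(\pi)+\mathrm{pone}(\pi)+(-n^2+n-2)/2$; $\mathrm{yzl2}'(\pi)=\mathrm{yzl2}(\pi)+2\,\mathrm{pone}(\pi)-n-1$; $\mathrm{yzl3}'(\pi)=\mathrm{yzl3}(\pi)+n\,\mathrm{exc}(\pi)-n(n-1)/2$; $\mathrm{yzl4}'(\pi)=\mathrm{yzl4}(\pi)+\mathrm{exc}(\pi)+\mathrm{pone}(\pi)-n$. In particular, for each permutation $\pi$, $$\mathrm{mad}'(\pi)=\mathrm{sist}''(\pi^{\mathrm c}),\qquad \mathrm{madl}'(\pi)=\mathrm{sist}'(\pi^{\mathrm c}),\qquad \mathrm{makl}'(\pi)=\mathrm{makl}(\pi^{\mathrm c}).$$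
   Context: $\mathfrak S_n$ is the set of permutations $\pi=\pi_1\cdots\pi_n$ of $[n]=\{1,\dots,n\}$, $\pi_i=\pi(i)$. $\mathrm{inv}(\pi)=\#\{1\le i<j\le n:\pi_i>\pi_j\}$. A statistic is Mahonian if for every $n\ge1$ it is equidistributed with $\mathrm{inv}$ over $\mathfrak S_n$. The complement $\pi^{\mathrm c}$ is $\pi^{\mathrm c}(i)=n+1-\pi(i)$. Vincular pattern counts: for a pattern with underlined adjacent letters, its value on $\pi$ is the number of subsequences of $\pi$ order-isomorphic to the pattern in which the underlined letters occupy adjacent positions of $\pi$; e.g. $2\underline{31}(\pi)=\#\{(i,j): i<j<n,\ \pi_{j+1}<\pi_i<\pi_j\}$, $\underline{31}2(\pi)=\#\{(j,i): j+1<i,\ \pi_{j+1}<\pi_i<\pi_j\}$, $\underline{13}2(\pi)=\#\{(j,i): j+1<i,\ \pi_j<\pi_i<\pi_{j+1}\}$. $\mathrm{des}(\pi)=\underline{21}(\pi)$ is the number of $i<n$ with $\pi_i>\pi_{i+1}$. Set $\mathrm{sist}'=\underline{13}2+\underline{13}2+2\underline{31}+\underline{21}$ and $\mathrm{sist}''=\underline{13}2+2\underline{31}+2\underline{31}+\underline{21}$. Linear statistics: $\mathrm{dbot}(\pi)=\sum_{i<n,\ \pi_i>\pi_{i+1}}\pi_{i+1}$, $\mathrm{ddif}(\pi)=\sum_{i<n,\ \pi_i>\pi_{i+1}}(\pi_i-\pi_{i+1})$, $\mathrm{mak}=\mathrm{dbot}+2\underline{31}$, $\mathrm{mad}=\mathrm{ddif}+2\underline{31}$,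 $\mathrm{makl}=\mathrm{dbot}+\underline{31}2$, $\mathrm{madl}=\mathrm{ddif}+\underline{31}2$. Cyclic statistics: $\mathrm{Ep}(\pi)=\{i\in[n]:\pi(i)>i\}$, $\mathrm{exc}(\pi)=|\mathrm{Ep}(\pi)|$, $\mathrm{ebot}(\pi)=\sum_{i\in\mathrm{Ep}(\pi)}i$, $\mathrm{edif}(\pi)=\sum_{i\in\mathrm{Ep}(\pi)}(\pi(i)-i)$. Side numbers: if $i\in\mathrm{Ep}(\pi)$, $s_i=\#\{j\in\mathrm{Ep}(\pi): j<i,\ \pi(j)>\pi(i)\}$; if $i\notin\mathrm{Ep}(\pi)$, $s_i=\#\{j\notin\mathrm{Ep}(\pi): j>i,\ \pi(j)<\pi(i)\}$. $\mathrm{ine}(\pi)=\sum_{i=1}^n s_i$ and $\mathrm{den}(\pi)=\mathrm{ebot}(\pi)+\mathrm{ine}(\pi)$. Shifted cyclic statistics: $\mathrm{pone}(\pi)=\pi^{-1}(1)$; $\mathrm{vbot}(\pi)$ is the sum of all $i\in[n-1]$ such that $i+1$ is not of the form $\pi(k)$ with $\pi(k)>k$; $\mathrm{vedif}(\pi)=\sum_{i\in\mathrm{Ep}(\pi)}(\pi(i)-i-1)+(n-\mathrm{pone}(\pi))$; $\mathrm{vnest}(\pi)=\sum_{i=1}^n\mathrm{vnest}_i(\pi)$, where $\mathrm{nest}_i(\pi)=\#\{j: j<i<\pi(i)<\pi(j)\text{ or }\pi(j)<\pi(i)\le i<j\}$ and $\mathrm{vnest}_i(\pi)=\mathrm{nest}_i(\pi)-1$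 if $\pi(i)\le i$ and $i<\mathrm{pone}(\pi)$; $\mathrm{vnest}_i(\pi)=\mathrm{nest}_i(\pi)+1$ if $\pi(i)>i$ and $i>\mathrm{pone}(\pi)$; $\mathrm{vnest}_i(\pi)=\mathrm{nest}_i(\pi)$ otherwise. *)

(* Defs.v *)
From mathcomp Require Import all_boot all_order all_fingroup all_algebra.
Set Implicit Arguments.
Unset Strict Implicit.
Unset Printing Implicit Defensive.
Import Order.TTheory GRing.Theory Num.Theory.

Local Open Scope ring_scope.

(* Permutations of [n] are elements of 'S_n: the ordinal i stands for the     *)
(* element i.+1 of [n].  Comparisons between positions and/or values are      *)
(* insensitive to this shift; whenever a position or a value is used as a     *)
(* number, the shift is made explicit with ".+1".                             *)

Definition statistic := forall n : nat, 'S_n -> int.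

(* letter pi i is the value pi_i = pi(i) in [n], for 1 <= i <= n, both        *)
(* numbered from 1 (and the junk value 0 for i outside [n]).                  *)
Definition letter n (pi : 'S_n) (i : nat) : nat :=
  (\sum_(k < n | k.+1 == i) (pi k).+1)%N.

Definition last_letter n (pi : 'S_n) : int := (letter pi n)%:Z.

Definition complement n (pi : 'S_n) : 'S_n :=
  perm (inj_comp (@rev_ord_inj n) (@perm_inj _ pi)).

Definition inversions : statistic := fun n pi =>
  #|[set p : 'I_n * 'I_n | (p.1 < p.2)%N && (pi p.2 < pi p.1)%N]|%:Z.

Definition mahonian (st : statistic) : Prop :=
  forall n : nat, (0 < n)%N -> forall k : int,
    #|[set pi : 'S_n | st n pi == k]| = #|[set pi : 'S_n | inversions pi == k]|.

(* Exact halving: only ever applied to even integers, among them n (n - 1),   *)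
(* n (n - 3) and - n ^ 2 + n - 2.                                             *)
Definition half_int (m : int) : int := (m %/ 2)%Z.

Definition order_iso (s t : seq nat) : bool :=
  (size s == size t) &&
  [forall a : 'I_(size s), forall b : 'I_(size s),
    (nth 0 s a < nth 0 s b)%N == (nth 0 t a < nth 0 t b)%N].

(* A vincular pattern is given by its word p and by the list u of the indices *)
(* j, counted from 0, such that the letters j and j.+1 of p are underlined    *)
(* together.  The tuple t lists the positions of an occurrence.               *)
Definition vincular (p u : seq nat) : statistic := fun n pi =>
  #|[set t : (size p).-tuple 'I_n |
      let pos := [seq val i | i <- t] in
      [&& sorted ltn pos,
          all (fun j => nth 0 pos j.+1 == (nth 0 pos j).+1)%N u
        & order_iso [seq val (pi i) | i <- t] p]]|%:Z.

(* The underscore separates the underlined pair from the remaining letter:    *)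
(* in 2_31 the letters 31 are underlined, in 31_2 and 13_2 the first two.     *)
Definition pat2_31 : statistic := vincular [:: 2; 3; 1]%N [:: 1]%N.
Definition pat31_2 : statistic := vincular [:: 3; 1; 2]%N [:: 0]%N.
Definition pat13_2 : statistic := vincular [:: 1; 3; 2]%N [:: 0]%N.
Definition pat21 : statistic := vincular [:: 2; 1]%N [:: 0]%N.

Definition des : statistic := pat21.

Definition sist' : statistic := fun n pi =>
  pat13_2 pi + pat13_2 pi + pat2_31 pi + pat21 pi.
Definition sist'' : statistic := fun n pi =>
  pat13_2 pi + pat2_31 pi + pat2_31 pi + pat21 pi.

Definition dbot : statistic := fun n pi =>
  \sum_(1 <= i < n | (letter pi i.+1 < letter pi i)%N) (letter pi i.+1)%:Z.
Definition ddif : statistic := fun n pi =>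
  \sum_(1 <= i < n | (letter pi i.+1 < letter pi i)%N)
    ((letter pi i)%:Z - (letter pi i.+1)%:Z).

Definition mak : statistic := fun n pi => dbot pi + pat2_31 pi.
Definition mad : statistic := fun n pi => ddif pi + pat2_31 pi.
Definition makl : statistic := fun n pi => dbot pi + pat31_2 pi.
Definition madl : statistic := fun n pi => ddif pi + pat31_2 pi.

Definition Ep n (pi : 'S_n) : {set 'I_n} := [set i : 'I_n | (i < pi i)%N].

Definition exc : statistic := fun n pi => #|Ep pi|%:Z.
Definition ebot : statistic := fun n pi => \sum_(i in Ep pi) i.+1%:Z.
Definition edif : statistic := fun n pi =>
  \sum_(i in Ep pi) ((pi i).+1%:Z - i.+1%:Z).

Definition side n (pi : 'S_n) (i : 'I_n) : int :=
  if i \in Ep pi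
  then #|[set j : 'I_n | [&& j \in Ep pi, (j < i)%N & (pi i < pi j)%N]]|%:Z
  else #|[set j : 'I_n | [&& j \notin Ep pi, (i < j)%N & (pi j < pi i)%N]]|%:Z.

Definition ine : statistic := fun n pi => \sum_(i < n) side pi i.
Definition den : statistic := fun n pi => ebot pi + ine pi.

Definition pone : statistic := fun n pi => (letter (pi^-1)%g 1)%:Z.

Definition vbot : statistic := fun n pi =>
  \sum_(1 <= i < n | ~~ [exists k in Ep pi, (pi k).+1 == i.+1]) i%:Z.

Definition vedif : statistic := fun n pi =>
  \sum_(i in Ep pi) ((pi i).+1%:Z - i.+1%:Z - 1) + (n%:Z - pone pi).

Definition nest n (pi : 'S_n) (i : 'I_n) : int :=
  #|[set j : 'I_n | [&& (j < i)%N, (i < pi i)%N & (pi i < pi j)%N]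
                 || [&& (pi j < pi i)%N, (pi i <= i)%N & (i < j)%N]]|%:Z.

Definition vnest_at n (pi : 'S_n) (i : 'I_n) : int :=
  if (pi i <= i)%N && (i.+1%:Z < pone pi) then nest pi i - 1
  else if (i < pi i)%N && (pone pi < i.+1%:Z) then nest pi i + 1
  else nest pi i.

Definition vnest : statistic := fun n pi => \sum_(i < n) vnest_at pi i.

Definition mak' : statistic := fun n pi =>
  mak pi + (1 - n%:Z) * des pi + last_letter pi + half_int (n%:Z * (n%:Z - 3)).
Definition mad' : statistic := fun n pi =>
  mad pi + 2 * last_letter pi - n%:Z - 1.
Definition makl' : statistic := fun n pi =>
  makl pi - n%:Z * des pi + half_int (n%:Z * (n%:Z - 1)).
Definition madl' : statistic := fun n pi =>
  madl pi - des pi + last_letter pi - 1.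

Definition fz3 : statistic := fun n pi =>
  ebot pi + edif pi - exc pi - ine pi.
Definition fz4 : statistic := fun n pi => 2 * edif pi - exc pi - ine pi.

Definition inv' : statistic := fun n pi =>
  inversions pi + 2 * last_letter pi - 1 - n%:Z.
Definition den' : statistic := fun n pi =>
  den pi + (1 - n%:Z) * exc pi + last_letter pi + half_int (n%:Z * (n%:Z - 3)).
Definition fz3' : statistic := fun n pi =>
  fz3 pi - n%:Z * exc pi + half_int (n%:Z * (n%:Z - 1)).
Definition fz4' : statistic := fun n pi =>
  fz4 pi - exc pi + last_letter pi - 1.

Definition yzl1 : statistic := fun n pi => vbot pi + vnest pi.
Definition yzl2 : statistic := fun n pi => vedif pi + vnest pi.
Definition yzl3 : statistic := fun n pi =>
  vbot pi + vedif pi - (n%:Z - 1 - exc pi) - vnest pi.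
Definition yzl4 : statistic := fun n pi =>
  2 * vedif pi - (n%:Z - 1 - exc pi) - vnest pi.

Definition yzl1' : statistic := fun n pi =>
  yzl1 pi + (n%:Z - 1) * exc pi + pone pi + half_int (- n%:Z ^+ 2 + n%:Z - 2).
Definition yzl2' : statistic := fun n pi =>
  yzl2 pi + 2 * pone pi - n%:Z - 1.
Definition yzl3' : statistic := fun n pi =>
  yzl3 pi + n%:Z * exc pi - half_int (n%:Z * (n%:Z - 1)).
Definition yzl4' : statistic := fun n pi =>
  yzl4 pi + exc pi + pone pi - n%:Z.

(* Main.v *)
Require Import Defs.
From mathcomp Require Import all_boot all_order all_fingroup all_algebra.
From mathcomp Require Import zify ring.

(* Three facts suffice.
   (1) den is Mahonian: den(pi) is the sum over i of the number of letters among
   pi_1 .. pi_(i-1) lying in the cyclic interval ]pi_i, i], and the word of these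
   numbers is a subexcedant code of pi, as is the word of the inversion numbers.
   (2) The linear tuple (des, dbot, ddif, 2_31, pi_n) and the cyclic tuple
   (exc, ebot, edif, ine, pi_n) are equidistributed: both are functions of a
   Laguerre history that records, for each value v, whether v is a descent
   bottom (excedance position), whether it is a descent top (excedance value),
   and its contribution to 2_31 (to ine).  Both encodings are injective and
   there are exactly n! histories.  Since ddif - des = 2_31 + 31_2 and
   mad o rc = madl for the reverse-complement rc, this turns fz4 into
   inv = edif + ine.
   (3) The map rho : pi |-> (i |-> pi^-1(i) + 1 mod n) and the inverse of the
   reverse-complement act on the cyclic tuples by affine maps, which carry inv,
   den and fz4 to all the other cyclic and shifted cyclic statistics. *)

Set Implicit Arguments.
Unset Strict Implicit.
Unset Printing Implicit Defensive.
Import Order.TTheory GRing.Theory Num.Theory.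
Local Open Scope ring_scope.

(** * Indicator sums and the basic cyclic statistics *)

Local Notation "b %:B" := (Posz (nat_of_bool b))
  (at level 2, left associativity, format "b %:B").

Lemma cardsz (T : finType) (P : pred T) :
  #|[set x | P x]|%:Z = \sum_x (P x)%:B.
Proof.
rewrite cardsE -[LHS]natz -sum1_card natr_sum big_mkcond /=.
by apply: eq_bigr => x _; rewrite unfold_in; case: (P x).
Qed.

Lemma sumz_pair n (P : 'I_n -> 'I_n -> bool) :
  #|[set p : 'I_n * 'I_n | P p.1 p.2]|%:Z = \sum_i \sum_j (P i j)%:B.
Proof. by rewrite cardsz pair_bigA. Qed.

Lemma sum_indicator n (v : 'I_n) (F : 'I_n -> int) :
  \sum_i (i == v)%:B * F i = F v.
Proof.
rewrite (bigD1 v) //= eqxx mul1r big1 ?addr0 // => i /negPf->.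
by rewrite mul0r.
Qed.

Lemma sum_val n : \sum_(i < n) i%:Z = half_int (n%:Z * (n%:Z - 1)).
Proof.
have -> : n%:Z * (n%:Z - 1) = (\sum_(i < n) i%:Z) * 2.
  elim: n => [|n IHn]; first by rewrite big_ord0 mul0r.
  rewrite big_ord_recr /= mulrDl -IHn; lia.
by rewrite /half_int mulzK.
Qed.

Lemma half_n_n3 (n : nat) :
  half_int (n%:Z * (n%:Z - 3)) = half_int (n%:Z * (n%:Z - 1)) - n%:Z.
Proof.
rewrite /half_int.
have -> : n%:Z * (n%:Z - 3) = - n%:Z * 2 + n%:Z * (n%:Z - 1) by ring.
by rewrite divzMDl // addrC.
Qed.

Lemma half_n_n1K (n : nat) :
  half_int (n%:Z * (n%:Z - 1)) * 2 = n%:Z * (n%:Z - 1).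
Proof.
rewrite -sum_val; elim: n => [|n IHn]; first by rewrite big_ord0 mul0r.
rewrite big_ord_recr /= mulrDl IHn; lia.
Qed.

Lemma half_opp_n2 (n : nat) :
  half_int (- n%:Z ^+ 2 + n%:Z - 2) = - half_int (n%:Z * (n%:Z - 1)) - 1.
Proof.
have -> : - n%:Z ^+ 2 + n%:Z - 2 = (- half_int (n%:Z * (n%:Z - 1)) - 1) * 2.
  by rewrite mulrBl mulNr half_n_n1K; ring.
by rewrite /half_int mulzK.
Qed.

Lemma sum_lt n k : (k <= n)%N -> \sum_(i < n) (i < k)%N%:B = k%:Z.
Proof.
elim: n k => [|n IHn] k; first by rewrite big_ord0; case: k.
rewrite leq_eqVlt => /predU1P[->|ltkn].
  under eq_bigr => i _ do rewrite ltn_ord.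
  by rewrite sumr_const card_ord; lia.
by rewrite big_ord_recr /= IHn // ltnNge -ltnS ltkn addr0.
Qed.

Lemma sum_perm n (p : 'S_n) (F : 'I_n -> int) : \sum_i F (p i) = \sum_i F i.
Proof. by rewrite [RHS](reindex_inj (@perm_inj _ p)). Qed.

Lemma sum_perm_lt n (p : 'S_n) (v : 'I_n) : \sum_i (p i < v)%N%:B = v%:Z.
Proof.
by rewrite (sum_perm p (fun j => (j < v)%N%:B)) sum_lt // ltnW.
Qed.

(** Both disequalities are over natural numbers, the form in which [lia] can use them. *)
Lemma perm_val_neq n (p : 'S_n) (i j : 'I_n) :
  i != j -> ((i : nat) != j) && ((p i : nat) != p j).
Proof. by rewrite !(inj_eq val_inj) (inj_eq perm_inj) andbb. Qed.

Lemma inversionsE n (p : 'S_n) :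
  inversions p = \sum_(i < n) \sum_(j < n) ((i < j) && (p j < p i))%N%:B.
Proof. exact: sumz_pair. Qed.

Lemma excE n (p : 'S_n) : exc p = \sum_(i < n) (i < p i)%N%:B.
Proof. exact: cardsz. Qed.

Lemma ebotE n (p : 'S_n) : ebot p = \sum_(i < n) (i < p i)%N%:B * (i%:Z + 1).
Proof.
rewrite /ebot big_mkcond /=; apply: eq_bigr => i _.
rewrite inE; case: ltnP; lia.
Qed.

Lemma edifE n (p : 'S_n) :
  edif p = \sum_(i < n) (i < p i)%N%:B * ((p i)%:Z - i%:Z).
Proof.
rewrite /edif big_mkcond /=; apply: eq_bigr => i _.
rewrite inE; case: ltnP; lia.
Qed.

Lemma sideE n (p : 'S_n) (i : 'I_n) :
  side p i = if (i < p i)%N then \sum_(j < n) ((j < i) && (p i < p j))%N%:B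
             else \sum_(j < n) ((i < j) && (p j < p i))%N%:B.
Proof.
rewrite /side inE; case: ltnP => lt_ip; rewrite cardsz;
  apply: eq_bigr => j _; rewrite inE; lia.
Qed.

(* For an excedance i, [p i] letters are smaller than [p i], and those on the
   left of i number i minus the larger letters on the left of i. *)
Lemma side_inversions n (p : 'S_n) (i : 'I_n) :
  \sum_(j < n) ((i < j) && (p j < p i))%N%:B =
  (i < p i)%N%:B * ((p i)%:Z - i%:Z) + side p i.
Proof.
rewrite sideE; case: ltnP => lt_ip; last by rewrite mul0r add0r.
rewrite mul1r -(sum_perm_lt p (p i)) -[X in _ - X](sum_lt (ltnW (ltn_ord i))).
rewrite -sumrB -big_split /=; apply: eq_bigr => j _.
have [->|/(perm_val_neq p)] := eqVneq j i; lia.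
Qed.

Lemma inv_edif_ine n (p : 'S_n) : inversions p = edif p + ine p.
Proof.
rewrite inversionsE edifE /ine -big_split; apply: eq_bigr => i _.
exact: side_inversions.
Qed.

(** Excedance values are counted from 0 on the left and from 1 in [ebot + edif], whence the
    correction by [exc]. *)
Lemma sum_exc_top n (p : 'S_n) :
  \sum_(i < n) (i < p i)%N%:B * (p i)%:Z = ebot p + edif p - exc p.
Proof.
rewrite ebotE edifE excE -big_split -sumrB; apply: eq_bigr => i _ /=; lia.
Qed.

(** * Symmetries of the cyclic statistics *)

(** The map rho: products of permutations act from left to right, so [i] goes to the cyclic
    successor of [p^-1 i]. *)
Definition shift_inverse n (p : 'S_n) : 'S_n := (p^-1 * perm (@ordS_inj n))%g.

Lemma shift_inverseE n (p : 'S_n) i : shift_inverse p (p i) = ordS i.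
Proof. by rewrite permM permK permE. Qed.

Lemma shift_inverse_inj n : injective (@shift_inverse n).
Proof. by move=> p q /mulIg/invg_inj. Qed.

Lemma ordS_val m (i : 'I_m.+1) :
  ordS i = (if i == ord_max then 0 else i.+1) :> nat.
Proof.
rewrite /= -(inj_eq val_inj) /=.
have [->|ne] := eqVneq (i : nat) m; first by rewrite modnn.
rewrite modn_small //; have := ltn_ord i; lia.
Qed.

Lemma letterE m (p : 'S_m.+1) (i : 'I_m.+1) : letter p i.+1 = (p i).+1.
Proof. by rewrite /letter (big_pred1 i). Qed.

Lemma last_letterE m (p : 'S_m.+1) : last_letter p = (p ord_max)%:Z + 1.
Proof.
by rewrite /last_letter -[X in letter p X]/(ord_max : 'I_m.+1).+1 letterE; lia.
Qed.

Lemma poneE m (p : 'S_m.+1) : pone p = (p^-1 ord0)%g%:Z + 1.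
Proof. by rewrite /pone -[X in letter _ X]/(ord0 : 'I_m.+1).+1 letterE; lia. Qed.

Lemma sum_shift_inverse m (p : 'S_m.+1) (F : 'I_m.+1 -> 'I_m.+1 -> int) :
  \sum_i F i (shift_inverse p i) = \sum_i F (p i) (ordS i).
Proof.
rewrite -(sum_perm p); apply: eq_bigr => i _; by rewrite shift_inverseE.
Qed.

(** The position [p i] is an excedance of the image exactly when [i] is not one of [p], except that
    the last position wraps around to 0 and is lost. The terms in [i == ord_max], here and below,
    account for this wrap. *)
Lemma exc_shift_inverse m (p : 'S_m.+1) :
  exc (shift_inverse p) = m%:Z - exc p.
Proof.
rewrite excE (sum_shift_inverse p (fun i j => (i < j)%N%:B)).
transitivity (\sum_(i < m.+1) (1 - (i < p i)%N%:B - (i == ord_max)%:B * 1)).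
  apply: eq_bigr => i _; rewrite ordS_val.
  have := ltn_ord i; have := ltn_ord (p i).
  by case: eqVneq => [->|/(perm_val_neq p)] /=; case: ltnP => /=; lia.
rewrite !sumrB sum_indicator -excE sumr_const card_ord; lia.
Qed.

Lemma ebot_shift_inverse m (p : 'S_m.+1) :
  ebot (shift_inverse p) =
  half_int (m.+1%:Z * (m.+1%:Z - 1)) + m%:Z - (p ord_max)%:Z
  - ebot p - edif p.
Proof.
rewrite ebotE (sum_shift_inverse p (fun i j => (i < j)%N%:B * (i%:Z + 1))).
transitivity (\sum_(i < m.+1) ((p i)%:Z + 1 - (i < p i)%N%:B * (p i)%:Z
   - (i < p i)%N%:B - (i == ord_max)%:B * ((p i)%:Z + 1))).
  apply: eq_bigr => i _; rewrite ordS_val.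
  have := ltn_ord i; have := ltn_ord (p i).
  by case: eqVneq => [->|/(perm_val_neq p)] /=; case: ltnP => /=; lia.
rewrite !sumrB sum_indicator big_split -excE sum_exc_top sumr_const card_ord /=.
rewrite (sum_perm p (fun j => j%:Z)) sum_val; lia.
Qed.

Lemma edif_shift_inverse m (p : 'S_m.+1) :
  edif (shift_inverse p) = edif p - exc p + (p ord_max)%:Z.
Proof.
rewrite edifE (sum_shift_inverse p (fun i j => (i < j)%N%:B * (j%:Z - i%:Z))).
transitivity (\sum_(i < m.+1) (1 + i%:Z - (p i)%:Z
   + (i < p i)%N%:B * ((p i)%:Z - i%:Z) - (i < p i)%N%:B
   - (i == ord_max)%:B * (m.+1%:Z - (p i)%:Z))).
  apply: eq_bigr => i _; rewrite ordS_val.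
  have := ltn_ord i; have := ltn_ord (p i).
  by case: eqVneq => [->|/(perm_val_neq p)] /=; case: ltnP => /=; lia.
rewrite !sumrB !big_split sumrN sum_indicator -excE -edifE sumr_const card_ord.
rewrite (sum_perm p (fun j => j%:Z)) !sum_val /=; lia.
Qed.

(** The cyclic shift alters only comparisons with the last position: the [m - p ord_max] inversions
    involving the last letter give way to the [p ord_max] pairs formed with a smaller letter. *)
Lemma inv_shift_inverse m (p : 'S_m.+1) :
  inversions (shift_inverse p) = inversions p + 2 * (p ord_max)%:Z - m%:Z.
Proof.
have -> : inversions (shift_inverse p) =
    \sum_(a < m.+1) \sum_(b < m.+1) ((p a < p b) && (ordS b < ordS a))%N%:B.
  rewrite inversionsE -(sum_perm p); apply: eq_bigr => a _.
  by rewrite -(sum_perm p); apply: eq_bigr => b _; rewrite !shift_inverseE.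
transitivity (\sum_(a < m.+1) \sum_(b < m.+1)
   (((b < a) && (p a < p b))%N%:B
    + (b == ord_max)%:B * (p a < p b)%N%:B
    - (a == ord_max)%:B * (p a < p b)%N%:B)).
  apply: eq_bigr => a _; apply: eq_bigr => b _; rewrite !ordS_val.
  have := ltn_ord a; have := ltn_ord b.
  case: (eqVneq a ord_max) => [->|/(perm_val_neq p)];
    case: (eqVneq b ord_max) => [->|/(perm_val_neq p)] /=; lia.
under eq_bigr => a _ do rewrite sumrB big_split sum_indicator -mulr_sumr.
rewrite sumrB big_split sum_indicator sum_perm_lt exchange_big -inversionsE /=.
have -> : \sum_i (p ord_max < p i)%N%:B =
    \sum_(i < m.+1) (1 - (p i < p ord_max)%N%:B - (i == ord_max)%:B * 1).
  apply: eq_bigr => i _.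
  by have [->|/(perm_val_neq p)] := eqVneq i ord_max; lia.
rewrite !sumrB sum_perm_lt sum_indicator sumr_const card_ord; lia.
Qed.

(** Side numbers need no count of their own, since [ine] is [inversions - edif]. *)
Lemma ine_shift_inverse m (p : 'S_m.+1) :
  ine (shift_inverse p) = ine p + exc p + (p ord_max)%:Z - m%:Z.
Proof.
have := inv_shift_inverse p.
rewrite !inv_edif_ine edif_shift_inverse; lia.
Qed.

Lemma pone_shift_inverse m (p : 'S_m.+1) :
  pone (shift_inverse p) = (p ord_max)%:Z + 1.
Proof.
rewrite poneE; have -> : ord0 = shift_inverse p (p ord_max).
  by apply: val_inj; rewrite shift_inverseE [RHS]ordS_val eqxx.
by rewrite permK.
Qed.

(** Reflection of the arcs: [i -> p i] becomes [rev_ord (p i) -> rev_ord i], so excedances stay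
    excedances with the same difference, while positions and values swap roles. *)
Definition rev_compl_inverse n (p : 'S_n) : 'S_n :=
  (perm (@rev_ord_inj n) * p^-1 * perm (@rev_ord_inj n))%g.

Lemma rev_compl_inverseE n (p : 'S_n) i :
  rev_compl_inverse p (rev_ord (p i)) = rev_ord i.
Proof. by rewrite !permM [perm _ (rev_ord _)]permE rev_ordK permK permE. Qed.

Lemma rev_compl_inverse_inj n : injective (@rev_compl_inverse n).
Proof. by move=> p q /mulIg/mulgI/invg_inj. Qed.

Lemma sum_rev_perm n (p : 'S_n) (F : 'I_n -> int) :
  \sum_i F (rev_ord (p i)) = \sum_i F i.
Proof.
by rewrite (sum_perm p (fun i => F (rev_ord i))) [RHS](reindex_inj rev_ord_inj).
Qed.

Lemma edif_rev_compl_inverse n (p : 'S_n) : edif (rev_compl_inverse p) = edif p.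
Proof.
rewrite !edifE -(sum_rev_perm p); apply: eq_bigr => i _.
rewrite rev_compl_inverseE /=.
by have := ltn_ord i; have := ltn_ord (p i); lia.
Qed.

Lemma ebot_rev_compl_inverse n (p : 'S_n) :
  ebot (rev_compl_inverse p) = (n%:Z + 1) * exc p - ebot p - edif p.
Proof.
rewrite ebotE -(sum_rev_perm p).
transitivity (n%:Z * exc p - \sum_(i < n) (i < p i)%N%:B * (p i)%:Z);
  last by rewrite sum_exc_top; lia.
rewrite excE mulr_sumr -sumrB; apply: eq_bigr => i _.
rewrite rev_compl_inverseE /=.
have -> : (n - (p i).+1 < n - i.+1)%N = (i < p i)%N.
  by have := ltn_ord i; have := ltn_ord (p i); lia.
by have := ltn_ord (p i); case: (ltnP i (p i)) => /=; lia.
Qed.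

Lemma inv_rev_compl_inverse n (p : 'S_n) :
  inversions (rev_compl_inverse p) = inversions p.
Proof.
rewrite !inversionsE -(sum_rev_perm p).
apply: eq_bigr => a _; rewrite -(sum_rev_perm p); apply: eq_bigr => b _.
rewrite !rev_compl_inverseE /=.
have := ltn_ord a; have := ltn_ord (p a).
have := ltn_ord b; have := ltn_ord (p b); lia.
Qed.

Lemma ine_rev_compl_inverse n (p : 'S_n) : ine (rev_compl_inverse p) = ine p.
Proof.
have := inv_rev_compl_inverse p.
by rewrite !inv_edif_ine edif_rev_compl_inverse => /addrI.
Qed.

(** The letter [i + 1] of [n] is [i] when counted from 0, so [vbot] sums the letters from 0 that are
    not excedance values; the letter 0 adds nothing. *)
Lemma vbotE m (p : 'S_m.+1) :
  vbot p = half_int (m.+1%:Z * (m.+1%:Z - 1)) - (ebot p + edif p - exc p).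
Proof.
rewrite -sum_exc_top -sum_val -(sum_perm p) -sumrB /vbot.
rewrite -[RHS](sum_perm (p^-1)%g) big_mkcond big_add1 /= big_mkord.
rewrite big_ord_recl /= permKV /= mulr0 subrr add0r.
apply: eq_bigr => i _; rewrite permKV /= -[bump 0 i]/i.+1.
set v := lift ord0 i.
have -> : [exists k in Ep p, (p k).+1 == i.+2] = ((p^-1)%g v < v)%N.
  apply/existsP/idP => [[k]|lt_v].
    rewrite inE => /andP[lt_kp /eqP[E]].
    have <- : p k = v by apply: val_inj => /=; rewrite /bump; lia.
    by rewrite permK.
  by exists ((p^-1)%g v); rewrite inE permKV lt_v /=.
case: ltnP => _; rewrite /v /= /bump; lia.
Qed.

Lemma vedifE m (p : 'S_m.+1) :
  vedif p = edif p - exc p + m.+1%:Z - pone p.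
Proof.
rewrite /vedif addrA; congr (_ + _ - _); rewrite edifE excE big_mkcond -sumrB.
by apply: eq_bigr => i _; rewrite inE; case: ltnP => /=; lia.
Qed.

(** With [a] the position of the smallest letter, the correction in [vnest_at] is
    [(i < p i) - (i < a)]; at [i = a] there is no excedance. *)
Lemma vnestE m (p : 'S_m.+1) : vnest p = ine p + exc p + 1 - pone p.
Proof.
have pone_pos : p ((p^-1)%g ord0) = ord0 by rewrite permKV.
set a := (p^-1)%g ord0 in pone_pos.
have -> : ine p + exc p + 1 - pone p =
    \sum_(i < m.+1) (side p i + (i < p i)%N%:B - (i < a)%N%:B).
  rewrite sumrB big_split -excE sum_lt ?poneE; last exact: ltnW.
  by rewrite -/a -/(ine p) /=; lia.
apply: eq_bigr => i _.
have -> : side p i = nest p i.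
  rewrite sideE /nest cardsz; case: ltnP => lt_ip;
    apply: eq_bigr => j _; lia.
rewrite /vnest_at poneE -/a.
have [->|/(perm_val_neq p)] := eqVneq i a.
  by rewrite pone_pos /=; do ?case: ifP; lia.
rewrite pone_pos /=; do ?case: ifP; lia.
Qed.

(** * Codes of den and inv *)

(** Pigeonhole: an injective [g] into a list of length [n!] reaches every entry, so [phi p] can be
    chosen as a preimage under [g] of [f p]. *)
Lemma code_bijection n (T : eqType) (W : seq T) (f g : 'S_n -> T) :
  injective f -> injective g -> (forall p, f p \in W) -> (forall p, g p \in W) ->
  size W = n`! ->
  exists2 phi : 'S_n -> 'S_n, injective phi & forall p, f p = g (phi p).
Proof.
move=> f_inj g_inj fW gW sizeW.
have im_g : [seq g p | p <- enum {: 'S_n}] =i W.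
  have := @uniq_min_size _ [seq g p | p <- enum {: 'S_n}] W.
  case=> //; first by rewrite map_inj_uniq ?enum_uniq.
    by move=> _ /mapP[p _ ->].
  by rewrite size_map -cardE sizeW card_Sn.
have ex p : exists q, g q == f p.
  by have := fW p; rewrite -im_g => /mapP[q _ ->]; exists q.
exists (fun p => xchoose (ex p)) => [p q eq_pq|p]; last first.
  by rewrite (eqP (xchooseP (ex p))).
by apply: f_inj; rewrite -(eqP (xchooseP (ex p))) eq_pq (eqP (xchooseP (ex q))).
Qed.

Fixpoint subexcedant (n : nat) : seq (seq nat) :=
  if n is n'.+1 then [seq rcons w c | w <- subexcedant n', c <- iota 0 n]
  else [:: [::]].

Lemma size_subexcedant n : size (subexcedant n) = n`!.
Proof.
elim: n => // n IHn.
by rewrite [LHS]size_allpairs IHn size_iota factS mulnC.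
Qed.

Lemma mkseq_subexcedant (c : nat -> nat) n :
  (forall i, (i < n)%N -> (c i <= i)%N) -> mkseq c n \in subexcedant n.
Proof.
elim: n => // n IHn le_c; rewrite mkseqS.
apply: (@allpairs_f _ _ _ _ _ (iota 0 n.+1)).
  by apply: IHn => i lt_in; apply: le_c; apply: ltnW.
by rewrite mem_iota add0n ltnS le_c.
Qed.

Definition prefix_set n (p : 'S_n) (i : 'I_n) : {set 'I_n} :=
  [set u | ((p^-1)%g u <= i)%N].

Lemma card_prefix_set n (p : 'S_n) i : #|prefix_set p i| = i.+1.
Proof.
apply/eqP; rewrite -eqz_nat cardsz.
rewrite (sum_perm (p^-1)%g (fun j : 'I_n => (j < i.+1)%N%:B)) sum_lt //.
Qed.

Lemma mem_prefix_set n (p : 'S_n) i : p i \in prefix_set p i.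
Proof. by rewrite inE permK. Qed.

Lemma prefix_setS n (p q : 'S_n) (i : 'I_n) :
  (forall j : 'I_n, (i < j)%N -> p j = q j) -> prefix_set p i = prefix_set q i.
Proof.
move=> eq_pq; apply/setP => u; rewrite !inE leqNgt [RHS]leqNgt; congr (~~ _).
apply/idP/idP => [lt_i|lt_i].
  suff -> : (q^-1)%g u = (p^-1)%g u by [].
  by apply: (@perm_inj _ q); rewrite permKV -eq_pq ?permKV.
suff -> : (p^-1)%g u = (q^-1)%g u by [].
by apply: (@perm_inj _ p); rewrite permKV eq_pq ?permKV.
Qed.

(* Read from right to left, the word of codes determines the letters one by
   one, since at each step the set of remaining letters is known. *)
Lemma prefix_code_inj n (C : {set 'I_n} -> 'I_n -> 'I_n -> nat) :
  (forall (S : {set _}) (i : 'I__), #|S| = i.+1 -> {in S &, injective (C S i)}) ->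
  forall p q : 'S_n,
    (forall i, C (prefix_set p i) i (p i) = C (prefix_set q i) i (q i)) -> p = q.
Proof.
move=> C_inj p q eq_C; apply/permP => i.
have [k] := ubnP (n - i); elim: k i => // k IHk i lt_k.
have eqS : prefix_set p i = prefix_set q i.
  by apply: prefix_setS => j lt_ij; apply: IHk; have := ltn_ord j; lia.
apply: (C_inj _ i (card_prefix_set p i)); first exact: mem_prefix_set.
  by rewrite eqS mem_prefix_set.
by rewrite eq_C eqS.
Qed.

Definition inv_code n (S : {set 'I_n}) (i v : 'I_n) : nat :=
  #|[set u in S | (v < u)%N]|.

(* The number of letters of S in the cyclic interval ]v, i]. *)
Definition den_code n (S : {set 'I_n}) (i v : 'I_n) : nat :=
  if (v <= i)%N then #|[set u in S | (v < u <= i)%N]|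
  else (i - #|[set u in S | (i < u < v)%N]|)%N.

Lemma card_proper (T : finType) (S : {set T}) (P Q : pred T) v :
  v \in S -> Q v -> ~~ P v -> (forall u, u \in S -> P u -> Q u) ->
  (#|[set u in S | P u]| < #|[set u in S | Q u]|)%N.
Proof.
move=> vS Qv Pv PQ; apply: proper_card; apply/properP; split.
  by apply/subsetP => u; rewrite !inE => /andP[uS Pu]; rewrite uS PQ.
by exists v; rewrite !inE vS //= negb_and Pv.
Qed.

Lemma inv_code_inj n (S : {set 'I_n}) (i : 'I_n) :
  {in S &, injective (inv_code S i)}.
Proof.
suff lt v w : v \in S -> w \in S -> (v < w)%N -> inv_code S i v != inv_code S i w.
  move=> v w vS wS eq_vw; apply: val_inj.
  have [lt_vw|lt_wv|//] := ltngtP v w.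
    by move: (lt v w vS wS lt_vw); rewrite eq_vw eqxx.
  by move: (lt w v wS vS lt_wv); rewrite eq_vw eqxx.
move=> vS wS lt_vw; rewrite gtn_eqF //; apply: card_proper wS _ _ _ => //.
  by rewrite ltnn.
by move=> u _; apply: ltn_trans.
Qed.

(** The code is the rank of [v] in [S] when values are read downwards and cyclically from [i]. For
    [v > i] the elements of [S] in []i, v]], with [v] itself, are removed from the [i + 1] elements
    of [S]. *)
Lemma den_code_inj n (S : {set 'I_n}) (i : 'I_n) :
  #|S| = i.+1 -> {in S &, injective (den_code S i)}.
Proof.
move=> cardS.
have splitS : (#|[set u in S | (u <= i)%N]| + #|[set u in S | (i < u)%N]| = i.+1)%N.
  have -> : [set u in S | (u <= i)%N] = S :&: [set u : 'I_n | (u <= i)%N].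
    by apply/setP => u; rewrite !inE.
  have -> : [set u in S | (i < u)%N] = S :\: [set u : 'I_n | (u <= i)%N].
    by apply/setP => u; rewrite !inE -ltnNge andbC.
  by rewrite cardsID.
suff lt v w : v \in S -> w \in S -> (v < w)%N -> den_code S i v != den_code S i w.
  move=> v w vS wS eq_vw; apply: val_inj.
  have [lt_vw|lt_wv|//] := ltngtP v w.
    by move: (lt v w vS wS lt_vw); rewrite eq_vw eqxx.
  by move: (lt w v wS vS lt_wv); rewrite eq_vw eqxx.
move=> vS wS lt_vw; rewrite /den_code.
case: (leqP v i) => [le_vi|lt_iv]; case: (leqP w i) => [le_wi|lt_iw]; last 2 first.
- lia.
- have lt1 : (#|[set u in S | (i < u < v)%N]| < #|[set u in S | (i < u < w)%N]|)%N.
    by apply: card_proper vS _ _ _ => [||u _]; lia.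
  (* This bound makes the truncated subtraction in the code exact. *)
  have lt2 : (#|[set u in S | (i < u < w)%N]| < #|[set u in S | true]|)%N.
    by apply: card_proper wS _ _ _ => [||u _]; lia.
  have : (#|[set u in S | true]| <= #|S|)%N.
    by apply: subset_leq_card; apply/subsetP => u; rewrite !inE andbT.
  lia.
- rewrite gtn_eqF //; apply: card_proper wS _ _ _ => [||u _]; lia.
have lt1 : (#|[set u in S | (v < u <= i)%N]| < #|[set u in S | (u <= i)%N]|)%N.
  by apply: card_proper vS _ _ _ => [||u _]; lia.
have lt2 : (#|[set u in S | (i < u < w)%N]| < #|[set u in S | (i < u)%N]|)%N.
  by apply: card_proper wS _ _ _ => [||u _]; lia.
lia.
Qed.

Lemma card_prefix_sum n (p : 'S_n) i (P : pred 'I_n) :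
  #|[set u in prefix_set p i | P u]|%:Z = \sum_(j < n) ((j <= i)%N && P (p j))%:B.
Proof.
rewrite cardsz -(sum_perm p); apply: eq_bigr => j _.
by rewrite inE permK.
Qed.

Lemma inv_code_sum n (p : 'S_n) :
  inversions p = \sum_i (inv_code (prefix_set p i) i (p i))%:Z.
Proof.
rewrite inversionsE exchange_big; apply: eq_bigr => i _.
rewrite card_prefix_sum; apply: eq_bigr => j _ /=.
by have [->|/(perm_val_neq p)] := eqVneq j i; lia.
Qed.

Lemma inv_code_le n (p : 'S_n) i : (inv_code (prefix_set p i) i (p i) <= i)%N.
Proof.
rewrite -ltnS -(card_prefix_set p i) /inv_code.
apply: proper_card; apply/properP; split.
  by apply/subsetP => u; rewrite !inE => /andP[].
by exists (p i); rewrite !inE ?permK ?ltnn ?andbF.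
Qed.

Lemma den_code_le n (p : 'S_n) i : (den_code (prefix_set p i) i (p i) <= i)%N.
Proof.
rewrite /den_code; case: ifP => _; last exact: leq_subr.
apply: leq_trans (inv_code_le p i).
by apply: subset_leq_card; apply/subsetP => u; rewrite !inE; lia.
Qed.

(** If [p i <= i], removing the letters above [i] from those above [p i] leaves the interval []p i,
    i]]. If [p i > i], the letters above [i] are [p i], those above it, and those strictly
    between. *)
Lemma den_codeE n (p : 'S_n) i :
  (den_code (prefix_set p i) i (p i))%:Z =
  (i < p i)%N%:B * (i%:Z + 1) + (inv_code (prefix_set p i) i (p i))%:Z
  - \sum_(j < n) ((j <= i) && (i < p j))%N%:B.
Proof.
rewrite /den_code /inv_code; case: leqP => [le_pi|lt_ip].
  rewrite mul0r add0r !card_prefix_sum -sumrB; apply: eq_bigr => j _; lia.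
have le_i : (#|[set u in prefix_set p i | (i < u < p i)%N]| <= i)%N.
  rewrite -ltnS -{2}(card_prefix_set p i).
  apply: proper_card; apply/properP; split.
    by apply/subsetP => u; rewrite !inE => /andP[].
  by exists (p i); rewrite !inE ?permK // ltnn !andbF.
rewrite -subzn // !card_prefix_sum.
transitivity (i%:Z - \sum_(j < n) ((j <= i)%N && (i < p j < p i)%N)%:B); first by [].
rewrite mul1r -!addrA; congr (_ + _).
(* The constant 1 becomes the indicator of [j = i], so that the sums compare term by term. *)
rewrite -(sum_indicator i (fun=> 1)) -sumrN -sumrB -big_split.
apply: eq_bigr => j _ /=.
by have [->|/(perm_val_neq p)] := eqVneq j i; lia.
Qed.

(** The subtracted double sum counts, for each excedance [j], the [p j - j] indices with
    [j <= i < p j]. It is thus [edif], and [ebot + inversions - edif] is [den]. *)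
Lemma den_code_sum n (p : 'S_n) :
  den p = \sum_i (den_code (prefix_set p i) i (p i))%:Z.
Proof.
under eq_bigr => i _ do rewrite den_codeE.
rewrite sumrB big_split -ebotE -inv_code_sum inv_edif_ine /den.
suff -> : edif p = \sum_(i < n) \sum_(j < n) ((j <= i) && (i < p j))%N%:B.
  by rewrite /=; ring.
rewrite exchange_big edifE; apply: eq_bigr => j _ /=.
case: ltnP => lt_jp; last by rewrite mul0r big1 // => i _; lia.
rewrite mul1r -(sum_lt (ltnW (ltn_ord (p j)))) -(sum_lt (ltnW (ltn_ord j))) -sumrB.
apply: eq_bigr => i _; lia.
Qed.

Lemma den_inv_bijection m :
  exists2 phi : 'S_m.+1 -> 'S_m.+1, injective phi &
    forall p, den p = inversions (phi p).
Proof.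
pose T := 'I_m.+1; pose word (C : {set T} -> T -> T -> nat) (p : 'S_m.+1) :=
  mkseq (fun i => C (prefix_set p (inord i)) (inord i) (p (inord i))) m.+1 : seq nat.
have word_inj (C : {set T} -> T -> T -> nat) :
    (forall (S : {set T}) (i : T), #|S| = i.+1 -> {in S &, injective (C S i)}) ->
    injective (word C).
  move=> C_inj p q eq_w; apply: (prefix_code_inj C_inj) => i.
  by have := congr1 (fun w => nth 0%N w i) eq_w; rewrite !nth_mkseq // inord_val.
have word_in (C : {set T} -> T -> T -> nat) :
    (forall (p : 'S_m.+1) i, C (prefix_set p i) i (p i) <= i)%N ->
    forall p, word C p \in subexcedant m.+1.
  move=> leC p; apply: mkseq_subexcedant => i lt_i.
  by have := leC p (inord i); rewrite inordK.
have [phi phi_inj eq_w] := code_bijection (word_inj _ (@den_code_inj _))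
  (word_inj (@inv_code _) (fun S i _ => @inv_code_inj _ S i))
  (word_in _ (@den_code_le _)) (word_in _ (@inv_code_le _)) (size_subexcedant _).
exists phi => // p; rewrite den_code_sum inv_code_sum; apply: eq_bigr => i _.
have := congr1 (fun w => nth 0%N w i) (eq_w p).
by rewrite !nth_mkseq // inord_val => ->.
Qed.

(** * Vincular patterns as sums *)

(* Positions and letters are counted from 0; junk for [m < j]. *)
Definition nth_letter m (p : 'S_m.+1) (j : nat) : nat := p (inord j).

Lemma nth_letterE m (p : 'S_m.+1) (i : 'I_m.+1) : nth_letter p i = p i.
Proof. by rewrite /nth_letter inord_val. Qed.

Lemma nth_letter_neq m (p : 'S_m.+1) j k :
  (j <= m)%N -> (k <= m)%N -> j != k -> nth_letter p j != nth_letter p k.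
Proof.
move=> le_j le_k; apply: contraNneq => /val_inj/perm_inj/(congr1 val).
by rewrite /= !inordK // => ->.
Qed.

Lemma letter_nth m (p : 'S_m.+1) i :
  (i <= m)%N -> letter p i.+1 = (nth_letter p i).+1.
Proof. by move=> le_im; rewrite -{1}(@inordK m i) // letterE. Qed.

Definition descent m (p : 'S_m.+1) (j : nat) : bool :=
  (nth_letter p j.+1 < nth_letter p j)%N.

Lemma dbotE m (p : 'S_m.+1) :
  dbot p = \sum_(j < m) (descent p j)%:B * ((nth_letter p j.+1)%:Z + 1).
Proof.
rewrite /dbot big_add1 big_mkord big_mkcond /=; apply: eq_bigr => j _.
have lt_j := ltn_ord j; rewrite !letter_nth ?ltnS //; last exact: ltnW.
by rewrite /descent; case: ltnP; lia.
Qed.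

Lemma ddifE m (p : 'S_m.+1) :
  ddif p = \sum_(j < m) (descent p j)%:B *
    ((nth_letter p j)%:Z - (nth_letter p j.+1)%:Z).
Proof.
rewrite /ddif big_add1 big_mkord big_mkcond /=; apply: eq_bigr => j _.
have lt_j := ltn_ord j; rewrite !letter_nth ?ltnS //; last exact: ltnW.
by rewrite /descent; case: ltnP; lia.
Qed.

Lemma sum_cons_tuple (T : finType) k (F : k.+1.-tuple T -> int) :
  \sum_t F t = \sum_x \sum_(t : k.-tuple T) F [tuple of x :: t].
Proof.
rewrite pair_bigA /= (reindex (fun q : T * k.-tuple T => [tuple of q.1 :: q.2])) //.
exists (fun t => (thead t, [tuple of behead t])) => [[x t] _|t _] /=.
  by rewrite theadE; congr (_, _); apply: val_inj.
by rewrite -tuple_eta.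
Qed.

Lemma sum_nil_tuple (T : finType) (F : 0.-tuple T -> int) : \sum_t F t = F [tuple].
Proof. by rewrite (big_pred1 [tuple]) // => t; apply/esym/eqP; apply: tuple0. Qed.

Lemma forall_ord_all n (P : nat -> bool) : [forall a : 'I_n, P a] = all P (iota 0 n).
Proof.
apply/forallP/allP => [all_P i|all_P i]; last by apply: all_P; rewrite mem_iota /=.
by rewrite mem_iota => lt_i; exact: (all_P (Ordinal lt_i)).
Qed.

(** Quantifiers over ordinals become [all] over [iota], which computes on a concrete pattern and
    leaves a formula for [lia]. *)
Lemma order_iso_all s t :
  order_iso s t = (size s == size t) &&
    all (fun a => all (fun b =>
      (nth 0 s a < nth 0 s b)%N == (nth 0 t a < nth 0 t b)%N)
      (iota 0 (size s))) (iota 0 (size s)).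
Proof.
rewrite /order_iso; congr (_ && _); rewrite -forall_ord_all.
by apply: eq_forallb => a; rewrite -forall_ord_all.
Qed.

Lemma sum_adjacent m (F : 'I_m.+1 -> 'I_m.+1 -> int) :
  \sum_(j < m.+1) \sum_(k < m.+1) (k == j.+1 :> nat)%:B * F j k =
  \sum_(j < m) F (inord j) (inord j.+1).
Proof.
rewrite big_ord_recr /= [X in _ + X]big1 ?addr0 => [|k _]; last first.
  by rewrite ltn_eqF ?mul0r.
apply: eq_bigr => j _; have lt_j := ltn_ord j.
have -> : widen_ord (leqnSn m) j = inord j.
  by apply: val_inj; rewrite /= inordK // ltnW.
rewrite -[RHS](sum_indicator (inord j.+1)); apply: eq_bigr => k _.
by rewrite -(inj_eq val_inj) /= !inordK // ltnW.
Qed.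

Lemma sum_adjacent_letters m (p : 'S_m.+1) (G : nat -> nat -> nat -> int) :
  \sum_(j < m.+1) \sum_(k < m.+1) (k == j.+1 :> nat)%:B * G j (p j) (p k) =
  \sum_(j < m) G j (nth_letter p j) (nth_letter p j.+1).
Proof.
rewrite (sum_adjacent (fun j k => G j (p j) (p k))); apply: eq_bigr => j _.
by rewrite inordK // ltnW //= ltnS ltn_ord.
Qed.

Lemma pat2_31E m (p : 'S_m.+1) :
  pat2_31 p = \sum_(i < m.+1) \sum_(j < m)
    ((i < j) && (nth_letter p j.+1 < p i < nth_letter p j))%N%:B.
Proof.
rewrite /pat2_31 /vincular cardsz sum_cons_tuple; apply: eq_bigr => a _.
rewrite sum_cons_tuple.
under eq_bigr => b _ do rewrite sum_cons_tuple.
under eq_bigr => b _ do under eq_bigr => c _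
  do rewrite sum_nil_tuple order_iso_all /=.
rewrite -(sum_adjacent_letters p (fun j x y => ((a < j) && (y < p a < x))%N%:B)).
apply: eq_bigr => b _; apply: eq_bigr => c _.
lia.
Qed.

Lemma pat31_2E m (p : 'S_m.+1) :
  pat31_2 p = \sum_(i < m.+1) \sum_(j < m)
    ((j.+1 < i) && (nth_letter p j.+1 < p i < nth_letter p j))%N%:B.
Proof.
have -> : pat31_2 p = \sum_(j < m.+1) \sum_(k < m.+1) (k == j.+1 :> nat)%:B *
    \sum_(i < m.+1) ((j.+1 < i) && (p k < p i < p j))%N%:B.
  rewrite /pat31_2 /vincular cardsz sum_cons_tuple; apply: eq_bigr => a _.
  rewrite sum_cons_tuple; apply: eq_bigr => b _.
  rewrite sum_cons_tuple mulr_sumr; apply: eq_bigr => c _.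
  rewrite sum_nil_tuple order_iso_all /=; lia.
rewrite (sum_adjacent_letters p
  (fun j x y => \sum_(i < m.+1) ((j.+1 < i) && (y < p i < x))%N%:B)).
exact: exchange_big.
Qed.

Lemma pat13_2E m (p : 'S_m.+1) :
  pat13_2 p = \sum_(i < m.+1) \sum_(j < m)
    ((j.+1 < i) && (nth_letter p j < p i < nth_letter p j.+1))%N%:B.
Proof.
have -> : pat13_2 p = \sum_(j < m.+1) \sum_(k < m.+1) (k == j.+1 :> nat)%:B *
    \sum_(i < m.+1) ((j.+1 < i) && (p j < p i < p k))%N%:B.
  rewrite /pat13_2 /vincular cardsz sum_cons_tuple; apply: eq_bigr => a _.
  rewrite sum_cons_tuple; apply: eq_bigr => b _.
  rewrite sum_cons_tuple mulr_sumr; apply: eq_bigr => c _.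
  rewrite sum_nil_tuple order_iso_all /=; lia.
rewrite (sum_adjacent_letters p
  (fun j x y => \sum_(i < m.+1) ((j.+1 < i) && (x < p i < y))%N%:B)).
exact: exchange_big.
Qed.

Lemma desE m (p : 'S_m.+1) : des p = \sum_(j < m) (descent p j)%:B.
Proof.
rewrite -(sum_adjacent_letters p (fun j x y => (y < x)%N%:B)).
rewrite /des /pat21 /vincular cardsz sum_cons_tuple; apply: eq_bigr => a _.
rewrite sum_cons_tuple; apply: eq_bigr => b _.
rewrite sum_nil_tuple order_iso_all /=; lia.
Qed.

(** A descent from [x] to [y] has [x - y - 1] values strictly between; each of them stands either
    before the descent (2_31) or after it (31_2). *)
Lemma ddif_patterns m (p : 'S_m.+1) : ddif p - des p = pat2_31 p + pat31_2 p.
Proof.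
rewrite ddifE desE pat2_31E pat31_2E exchange_big [X in _ = _ + X]exchange_big.
rewrite -sumrB -big_split; apply: eq_bigr => j _ /=.
have lt_jm := ltn_ord j; rewrite -big_split /=.
transitivity (\sum_(i < m.+1) (nth_letter p j.+1 < p i < nth_letter p j)%N%:B).
  rewrite (sum_perm p (fun x => (nth_letter p j.+1 < x < nth_letter p j)%N%:B)).
  rewrite /descent; case: ltnP => le_y; last by rewrite mul0r big1 // => x _; lia.
  have lt_x : (nth_letter p j <= m)%N by rewrite -ltnS; apply: ltn_ord.
  transitivity (\sum_(x < m.+1) ((x < nth_letter p j)%N%:B
    - (x < (nth_letter p j.+1).+1)%N%:B)).
    by rewrite sumrB !sum_lt; lia.
  by apply: eq_bigr => x _; lia.
apply: eq_bigr => i _.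
have [->|/(perm_val_neq p)] := eqVneq i (inord j).
  by rewrite -/(nth_letter p j); lia.
have [->|/(perm_val_neq p)] := eqVneq i (inord j.+1).
  by rewrite -/(nth_letter p j.+1); lia.
rewrite !inordK; lia.
Qed.

Definition rev_compl n (p : 'S_n) : 'S_n :=
  (perm (@rev_ord_inj n) * p * perm (@rev_ord_inj n))%g.

Lemma rev_compl_inj n : injective (@rev_compl n).
Proof. by move=> p q /mulIg/mulgI. Qed.

Lemma rev_complE n (p : 'S_n) i : rev_compl p i = rev_ord (p (rev_ord i)).
Proof. by rewrite !permM [perm _ i]permE permE. Qed.

Lemma nth_letter_rev_compl m (p : 'S_m.+1) j :
  (j <= m)%N -> nth_letter (rev_compl p) j = (m - nth_letter p (m - j))%N.
Proof.
move=> le_jm; rewrite /nth_letter rev_complE /= subSS; congr (m - _)%N.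
by congr (nat_of_ord (p _)); apply: val_inj; rewrite /= !inordK //; lia.
Qed.

Lemma nth_letter_le m (p : 'S_m.+1) j : (nth_letter p j <= m)%N.
Proof. by rewrite -ltnS ltn_ord. Qed.

(** Reverse-complement preserves descents and their drops, and exchanges the letters before a
    descent with those after it. *)
Lemma mad_rev_compl m (p : 'S_m.+1) : mad (rev_compl p) = madl p.
Proof.
rewrite /mad /madl !ddifE pat2_31E pat31_2E; congr (_ + _).
  rewrite (reindex_inj rev_ord_inj) /=; apply: eq_bigr => j _.
  have lt_jm := ltn_ord j.
  rewrite /descent !nth_letter_rev_compl ?(leq_subr, leq_subLR) //; try lia.
  rewrite [(m - (m - j.+1).+1)%N](_ : _ = j :> nat); last lia.
  rewrite [(m - (m - j.+1))%N](_ : _ = j.+1 :> nat); last lia.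
  have := nth_letter_le p j; have := nth_letter_le p j.+1.
  by case: ltnP; case: ltnP; lia.
rewrite (reindex_inj rev_ord_inj) /=; apply: eq_bigr => i _.
rewrite rev_complE rev_ordK (reindex_inj rev_ord_inj) /=; apply: eq_bigr => j _.
have lt_jm := ltn_ord j; have := ltn_ord i.
rewrite !nth_letter_rev_compl; try lia.
rewrite [(m - (m - j.+1).+1)%N](_ : _ = j :> nat); last lia.
rewrite [(m - (m - j.+1))%N](_ : _ = j.+1 :> nat); last lia.
have := nth_letter_le p j; have := nth_letter_le p j.+1; have := ltn_ord (p i).
lia.
Qed.

Lemma sum_telescope_from (f : nat -> int) a m : (a <= m)%N ->
  \sum_(j < m) (a <= j)%N%:B * (f j.+1 - f j) = f m - f a.
Proof.
elim: m => [|m IHm]; first by rewrite leqn0 => /eqP->; rewrite big_ord0 subrr.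
rewrite leq_eqVlt => /predU1P[->|lt_am].
  by rewrite subrr big1 // => j _; rewrite leqNgt ltn_ord mul0r.
by rewrite big_ord_recr /= IHm // -ltnS lt_am mul1r; ring.
Qed.

Lemma sum_telescope_to (f : nat -> int) a m : (a <= m)%N ->
  \sum_(j < m) (j < a)%N%:B * (f j.+1 - f j) = f a - f 0%N.
Proof.
move=> le_am; have := sum_telescope_from f (leq0n m).
rewrite -(subrK (f a) (f m)) -(sum_telescope_from f le_am) => E.
apply: (@addrI _ (\sum_(j < m) (a <= j)%N%:B * (f j.+1 - f j))).
rewrite addrA -E -big_split; apply: eq_bigr => j _ /=; case: leqP => _ /=; ring.
Qed.

(** The vincular pattern 2_13, to which complementation sends 2_31. *)
Definition pat2_13_count m (p : 'S_m.+1) : int :=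
  \sum_(i < m.+1) \sum_(j < m)
    ((i < j) && (nth_letter p j < p i < nth_letter p j.+1))%N%:B.

(* For a fixed letter x, the signs of the ascents and descents across x
   telescope along the word. *)
Lemma pat2_13_2_31 m (p : 'S_m.+1) :
  pat2_13_count p - pat2_31 p = (p ord_max)%:Z - m%:Z + des p.
Proof.
rewrite pat2_31E -sumrB.
have -> : (p ord_max)%:Z - m%:Z + des p =
    \sum_(i < m.+1) (p i < p ord_max)%N%:B - \sum_(i < m) (1 - (descent p i)%:B).
  rewrite sum_perm_lt sumrB -desE sumr_const card_ord; lia.
rewrite big_ord_recr [in RHS]big_ord_recr /= ltnn addr0.
rewrite -[X in _ + X = _]sumrB -[RHS]sumrB [X in _ + X = _]big1 ?addr0 => [|j _];
  last by have := ltn_ord j; lia.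
apply: eq_bigr => i _; have lt_im := ltn_ord i.
set x := p _; pose f k := (x < nth_letter p k)%N%:B.
have Ex : x = nth_letter p i :> nat.
  by rewrite /x -nth_letterE.
rewrite -sumrB -nth_letterE.
transitivity (f m - f i.+1); last first.
  have := @nth_letter_neq m p i i.+1 (ltnW lt_im) lt_im.
  rewrite /f Ex /descent /=; lia.
rewrite -(sum_telescope_from f lt_im); apply: eq_bigr => j _.
have lt_jm := ltn_ord j; rewrite /f Ex.
have := @nth_letter_neq m p i j.+1 (ltnW lt_im) lt_jm.
have := @nth_letter_neq m p i j (ltnW lt_im) (ltnW lt_jm).
lia.
Qed.

(** The same telescoping, on the left of the letter at position [i + 1]: what remains is its
    comparison with the first letter and with its left neighbour. *)
Lemma pat31_2_13_2 m (p : 'S_m.+1) :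
  pat31_2 p - pat13_2 p = (nth_letter p 0)%:Z - des p.
Proof.
rewrite pat31_2E pat13_2E -sumrB desE -[nth_letter p 0]/(nat_of_ord _).
rewrite -(sum_perm_lt p) big_ord_recl [in RHS]big_ord_recl.
have E0 : inord 0 = ord0 :> 'I_m.+1 by apply: val_inj; rewrite /= inordK.
rewrite E0 ltnn add0r.
rewrite -[X in X + _ = _]sumrB -[RHS]sumrB [X in X + _ = _]big1 ?add0r => [|j _];
  last by rewrite /=; lia.
apply: eq_bigr => i _; have lt_im := ltn_ord i.
rewrite -[nat_of_ord (p (lift ord0 i))]nth_letterE.
rewrite -[nat_of_ord (lift ord0 i)]/(i.+1) -sumrB.
rewrite -[nat_of_ord (p ord0)]nth_letterE.
pose f k := (nth_letter p i.+1 < nth_letter p k)%N%:B.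
transitivity (- (f i - f 0%N)); last by rewrite /f /descent /=; ring.
rewrite -(sum_telescope_to f (ltnW lt_im)) -sumrN; apply: eq_bigr => j _.
have lt_jm := ltn_ord j; rewrite /f.
have := @nth_letter_neq m p i.+1 j.+1 lt_im lt_jm.
have := @nth_letter_neq m p i.+1 j lt_im (ltnW lt_jm).
lia.
Qed.

Lemma complementE n (p : 'S_n) i : complement p i = rev_ord (p i).
Proof. by rewrite permE. Qed.

Lemma nth_letter_complement m (p : 'S_m.+1) j :
  nth_letter (complement p) j = (m - nth_letter p j)%N.
Proof. by rewrite /nth_letter complementE. Qed.

Lemma descent_complement m (p : 'S_m.+1) j : (j < m)%N ->
  descent (complement p) j = ~~ descent p j.
Proof.
move=> lt_jm; rewrite /descent !nth_letter_complement.
have := nth_letter_le p j; have := nth_letter_le p j.+1.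
have := @nth_letter_neq m p j j.+1 (ltnW lt_jm) lt_jm; lia.
Qed.

Lemma des_complement m (p : 'S_m.+1) : des (complement p) = m%:Z - des p.
Proof.
rewrite !desE; transitivity (\sum_(j < m) (1 - (descent p j)%:B)).
  by apply: eq_bigr => j _; rewrite descent_complement //; case: descent.
by rewrite sumrB -desE sumr_const card_ord; lia.
Qed.

Lemma pat13_2_complement m (p : 'S_m.+1) : pat13_2 (complement p) = pat31_2 p.
Proof.
rewrite pat13_2E pat31_2E; apply: eq_bigr => i _; apply: eq_bigr => j _.
rewrite !nth_letter_complement complementE /=.
have := nth_letter_le p j; have := nth_letter_le p j.+1; have := ltn_ord (p i).
lia.
Qed.

Lemma pat31_2_complement m (p : 'S_m.+1) : pat31_2 (complement p) = pat13_2 p.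
Proof.
rewrite pat13_2E pat31_2E; apply: eq_bigr => i _; apply: eq_bigr => j _.
rewrite !nth_letter_complement complementE /=.
have := nth_letter_le p j; have := nth_letter_le p j.+1; have := ltn_ord (p i).
lia.
Qed.

Lemma pat2_31_complement m (p : 'S_m.+1) :
  pat2_31 (complement p) = pat2_13_count p.
Proof.
rewrite pat2_31E; apply: eq_bigr => i _; apply: eq_bigr => j _.
rewrite !nth_letter_complement complementE /=.
have := nth_letter_le p j; have := nth_letter_le p j.+1; have := ltn_ord (p i).
lia.
Qed.

(** Descent bottoms of the complement are complemented ascent tops of [p], so the sum is that over
    all letters but the first, minus that over descent bottoms. *)
Lemma dbot_complement m (p : 'S_m.+1) :
  dbot (complement p) =
  dbot p - m.+1%:Z * des p + half_int (m.+1%:Z * (m.+1%:Z - 1))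
  + (nth_letter p 0)%:Z - des p.
Proof.
have sum_letters : \sum_(j < m) (nth_letter p j.+1)%:Z =
    half_int (m.+1%:Z * (m.+1%:Z - 1)) - (nth_letter p 0)%:Z.
  rewrite -sum_val -(sum_perm p) big_ord_recl -nth_letterE addrC addKr.
  by apply: eq_bigr => j _; rewrite -nth_letterE.
rewrite dbotE.
transitivity (\sum_(j < m) (m.+1%:Z - (nth_letter p j.+1)%:Z
   - m.+1%:Z * (descent p j)%:B + (descent p j)%:B * ((nth_letter p j.+1)%:Z + 1)
   - (descent p j)%:B)).
  apply: eq_bigr => j _; rewrite descent_complement // nth_letter_complement.
  have := nth_letter_le p j.+1; case: descent => /=; lia.
rewrite sumrB big_split !sumrB sum_letters -mulr_sumr sumr_const card_ord.
rewrite -desE -dbotE; rewrite -mulr_natr natz.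
have -> : m.+1%:Z * m%:Z = half_int (m.+1%:Z * (m.+1%:Z - 1)) * 2.
  by rewrite half_n_n1K; congr (_ * _); lia.
rewrite /=; ring.
Qed.

Lemma mad'_complement m (p : 'S_m.+1) : mad' p = sist'' (complement p).
Proof.
rewrite /sist'' pat13_2_complement pat2_31_complement -/(des _) des_complement.
rewrite /mad' /mad last_letterE.
have := pat2_13_2_31 p; have := ddif_patterns p; lia.
Qed.

Lemma madl'_complement m (p : 'S_m.+1) : madl' p = sist' (complement p).
Proof.
rewrite /sist' pat13_2_complement pat2_31_complement -/(des _) des_complement.
rewrite /madl' /madl last_letterE.
have := pat2_13_2_31 p; have := ddif_patterns p; lia.
Qed.

(** The surplus [nth_letter p 0 - des p] left by [dbot_complement] is [pat31_2 p - pat13_2 p]. *)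
Lemma makl'_complement m (p : 'S_m.+1) : makl' p = makl (complement p).
Proof.
rewrite /makl' /makl dbot_complement pat31_2_complement.
have := pat31_2_13_2 p; lia.
Qed.

(** * Laguerre histories *)

Definition history_letter := (bool * bool * nat)%type.

(* Words of length n coding Motzkin paths from height 0 to height h; the step
   at the letter (b, t, c) changes the height k by b - t and 0 <= c <= k - t. *)
Fixpoint histories (n h : nat) : seq (seq history_letter) :=
  if n is n'.+1 then
    [seq rcons w (true, false, c) | w <- histories n' h.-1, c <- iota 0 h] ++
    [seq rcons w (false, false, c) | w <- histories n' h, c <- iota 0 h.+1] ++
    [seq rcons w (true, true, c) | w <- histories n' h, c <- iota 0 h] ++
    [seq rcons w (false, true, c) | w <- histories n' h.+1, c <- iota 0 h.+1]
  else if h is 0 then [:: [::]] else [::].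

(** The recursion of [histories] in its four cases, with the factor [n!] removed. Pascal's rule
    merges the terms in pairs, and [mul_bin_left] adds the two results. *)
Lemma histories_binomial n h :
  (h * 'C(n, h.-1) + h.+1 * 'C(n, h) + h * 'C(n, h) + h.+1 * 'C(n, h.+1) =
   n.+1 * 'C(n.+1, h))%N.
Proof.
case: h => [|h] /=; first by rewrite !bin0 bin1; lia.
transitivity (h.+1 * 'C(n.+1, h.+1) + h.+2 * 'C(n.+1, h.+2))%N.
  by rewrite !binS; lia.
rewrite (mul_bin_left n.+1 h.+1).
have [le_h|lt_h] := leqP h.+1 n.+1; last by rewrite bin_small // !muln0.
by rewrite -mulnDl subnKC.
Qed.

(** The final height is kept general for the induction; height 0 gives [n!]. *)
Lemma size_histories n h : size (histories n h) = (n`! * 'C(n, h))%N.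
Proof.
elim: n h => [|n IHn] h; first by case: h.
rewrite [histories _ _]/(_ ++ _ ++ _ ++ _) !size_cat.
transitivity (n`! * 'C(n, h.-1) * h + (n`! * 'C(n, h) * h.+1 +
  (n`! * 'C(n, h) * h + n`! * 'C(n, h.+1) * h.+1)))%N.
  by rewrite !size_allpairs !IHn !size_iota.
transitivity (n`! * (n.+1 * 'C(n.+1, h)))%N; last by rewrite factS; ring.
rewrite -histories_binomial.
ring.
Qed.

(** The height before [v] is the number of [b] minus the number of [t] below [v]. The hypothesis
    says [c <= k - t] and keeps the truncated subtraction exact. *)
Lemma mkseq_histories (b t : nat -> bool) (c : nat -> nat) n :
  (forall v, (v < n)%N -> c v + \sum_(u < v.+1) t u <= \sum_(u < v) b u)%N ->
  mkseq (fun v => (b v, t v, c v)) n \in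
    histories n (\sum_(u < n) b u - \sum_(u < n) t u)%N.
Proof.
elim: n => [|n IHn] le_c; first by rewrite !big_ord0.
have {}IHn := IHn (fun v lt_v => le_c v (ltnW lt_v)).
have sum_recr (f : nat -> bool) : (\sum_(u < n.+1) f u = \sum_(u < n) f u + f n)%N.
  by rewrite big_ord_recr.
have {le_c} := le_c n (ltnSn n); rewrite mkseqS !sum_recr.
move: IHn; set w := mkseq _ _.
move: (\sum_(u < n) b u)%N (\sum_(u < n) t u)%N => B T w_in.
have rcons_in k l h d (x : nat -> history_letter) : k = h -> (d < l)%N ->
    w \in histories n k ->
    rcons w (x d) \in [seq rcons w' (x d') | w' <- histories n h, d' <- iota 0 l].
  move=> -> lt_d w_h.
  apply: (@allpairs_f _ _ _ (fun w' d' => rcons w' (x d')) _ (iota 0 l)) => //.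
  by rewrite mem_iota.
rewrite [histories n.+1 _]/(_ ++ _ ++ _ ++ _) !mem_cat.
case: (b n); case: (t n) => le_c; apply/orP.
- right; apply/orP; right; apply/orP; left.
  by apply: (rcons_in _ _ _ _ (fun d => (true, true, d)) _ _ w_in); lia.
- by left; apply: (rcons_in _ _ _ _ (fun d => (true, false, d)) _ _ w_in); lia.
- right; apply/orP; right; apply/orP; right.
  by apply: (rcons_in _ _ _ _ (fun d => (false, true, d)) _ _ w_in); lia.
- right; apply/orP; left.
  by apply: (rcons_in _ _ _ _ (fun d => (false, false, d)) _ _ w_in); lia.
Qed.

Definition history m (x : 'I_m.+1 -> history_letter) : seq history_letter :=
  mkseq (fun v => x (inord v)) m.+1.

Lemma history_inj m (x y : 'I_m.+1 -> history_letter) :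
  history x = history y -> x =1 y.
Proof.
move=> eq_h v; have := congr1 (fun s => nth (x v) s v) eq_h.
by rewrite !nth_mkseq // inord_val.
Qed.

Lemma history_in m (b t : 'I_m.+1 -> bool) (c : 'I_m.+1 -> nat) :
  (forall v : 'I_m.+1, (c v)%:Z + \sum_(u < m.+1) ((u <= v)%N && t u)%:B <=
     \sum_(u < m.+1) ((u < v)%N && b u)%:B) ->
  \sum_u (b u)%:B = \sum_u (t u)%:B ->
  history (fun v => (b v, t v, c v)) \in histories m.+1 0.
Proof.
have sumE (f : 'I_m.+1 -> bool) k : (k <= m.+1)%N ->
    (\sum_(u < k) f (inord u))%N%:Z = \sum_(u < m.+1) ((u < k)%N && f u)%:B.
  move=> le_k; rewrite (big_ord_widen _ (fun u => nat_of_bool (f (inord u))) le_k).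
  rewrite big_mkcond -[LHS]natz natr_sum; apply: eq_bigr => u _.
  by rewrite inord_val natz; case: ifP.
move=> le_c eq_bt.
have -> : 0%N = (\sum_(u < m.+1) b (inord u) - \sum_(u < m.+1) t (inord u))%N.
  suff : (\sum_(u < m.+1) b (inord u))%N = (\sum_(u < m.+1) t (inord u))%N by lia.
  apply/eqP; rewrite -eqz_nat !sumE //; apply/eqP.
  move: eq_bt; congr (_ = _); apply: eq_bigr => u _; by rewrite ltn_ord.
apply: (mkseq_histories (b := fun u => b (inord u)) (t := fun u => t (inord u))
  (c := fun u => c (inord u))) => v lt_v.
have := le_c (inord v); rewrite inordK // -lez_nat PoszD !sumE //; last exact: ltnW.
Qed.

(** * The cyclic history *)

Definition side_count n (p : 'S_n) (i : 'I_n) : nat :=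
  if (i < p i)%N then #|[set j : 'I_n | (j < i)%N && (p i < p j)%N]|
  else #|[set j : 'I_n | (i < j)%N && (p j < p i)%N]|.

Lemma side_countE n (p : 'S_n) i : (side_count p i)%:Z = side p i.
Proof. by rewrite sideE /side_count; case: ltnP; rewrite cardsz. Qed.

(** The first flag reads [v] as a position; the other two entries read it as a value. *)
Definition cyclic_letter n (p : 'S_n) (v : 'I_n) : history_letter :=
  ((v < p v)%N, ((p^-1)%g v < v)%N, side_count p ((p^-1)%g v)).

Lemma sum_inv_perm n (p : 'S_n) (F : 'I_n -> 'I_n -> int) :
  \sum_v F ((p^-1)%g v) v = \sum_i F i (p i).
Proof.
rewrite -(sum_perm p (fun v => F ((p^-1)%g v) v)).
by apply: eq_bigr => i _; rewrite permK.
Qed.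

(** The height before [v] is the number of arcs [j < v <= p j]. For an excedance value these include
    the arcs of its side number and also the arc ending at [v]; for another value, the arcs of the
    side number go down across [v]. *)
Lemma cyclic_history_in m (p : 'S_m.+1) :
  history (cyclic_letter p) \in histories m.+1 0.
Proof.
apply: history_in; last first.
  by rewrite (sum_inv_perm p (fun i v => (i < v)%N%:B)).
move=> v; rewrite side_countE sideE permKV.
set i := (p^-1)%g v; have pi : p i = v by rewrite permKV.
rewrite (sum_inv_perm p (fun j u => ((u <= v)%N && (j < u)%N)%:B)).
case: ltnP => [lt_iv|le_vi].
  rewrite -big_split; apply: ler_sum => j _ /=; lia.
apply: (@le_trans _ _ (\sum_(j < m.+1) (j < v <= p j)%N%:B
    + \sum_(j < m.+1) ((p j <= v)%N && (j < p j)%N)%:B)); last first.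
  rewrite -big_split; apply: ler_sum => j _ /=.
  have [->|/(perm_val_neq p)] := eqVneq j i; first by rewrite pi; lia.
  by rewrite pi; lia.
rewrite lerD2r.
apply: (@le_trans _ _ (\sum_(j < m.+1) (p j < v <= j)%N%:B)).
  by apply: ler_sum => j _; lia.
(* As many arcs go up across [v] as come down, since [v] positions and [v] values lie below [v]. *)
rewrite -subr_ge0 -sumrB le_eqVlt eq_sym; apply/orP; left; apply/eqP.
transitivity (\sum_(j < m.+1) ((j < v)%N%:B - (p j < v)%N%:B)).
  by apply: eq_bigr => j _; lia.
by rewrite sumrB sum_perm_lt sum_lt ?subrr // ltnW.
Qed.

Lemma lt_code_inj n (S : {set 'I_n}) :
  {in S &, injective (fun v : 'I_n => #|[set u in S | (u < v)%N]|)}.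
Proof.
suff lt v w : v \in S -> w \in S -> (v < w)%N ->
    (#|[set u in S | (u < v)%N]| < #|[set u in S | (u < w)%N]|)%N.
  move=> v w vS wS eq_vw; apply: val_inj.
  have [/(lt _ _ vS wS)|/(lt _ _ wS vS)|//] := ltngtP v w;
    by rewrite eq_vw ltnn.
by move=> vS wS lt_vw; apply: card_proper vS _ _ _ => [||u _] //; lia.
Qed.

(* Excedance values are decoded in increasing order and the other values in
   decreasing order: each code is the rank of the position among those left. *)
Lemma cyclic_letter_inj n (p q : 'S_n) :
  cyclic_letter p =1 cyclic_letter q -> p = q.
Proof.
move=> eq_pq.
have eqb (u : 'I_n) : (u < p u)%N = (u < q u)%N by case: (eq_pq u).
have eqt (u : 'I_n) : ((p^-1)%g u < u)%N = ((q^-1)%g u < u)%N by case: (eq_pq u).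
have eqc (u : 'I_n) : side_count p ((p^-1)%g u) = side_count q ((q^-1)%g u).
  by case: (eq_pq u).
have exc_eq (v : 'I_n) : ((p^-1)%g v < v)%N -> (p^-1)%g v = (q^-1)%g v.
  have [k] := ubnP v; elim: k v => // k IHk v lt_vk exc_v.
  have {}IHk (u : 'I_n) : (u < v)%N -> ((p^-1)%g u < u)%N -> (p^-1)%g u = (q^-1)%g u.
    by move=> lt_uv; apply: IHk; apply: leq_trans lt_uv _.
  (* Positions of the excedance values not yet decoded. *)
  pose A r := [set j : 'I_n | (j < (r : 'S_n) j)%N && (v <= r j)%N].
  have eqA : A p = A q.
    apply/setP => j; rewrite !inE -eqb; case: ltnP => //= lt_jp.
    rewrite leqNgt [RHS]leqNgt; congr (~~ _).
    apply/idP/idP => lt_v.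
      by have := IHk (p j) lt_v; rewrite permK => /(_ lt_jp) {1}->; rewrite permKV.
    have := IHk (q j) lt_v; rewrite eqt permK -eqb => /(_ lt_jp) <-.
    by rewrite permKV.
  apply: (@lt_code_inj _ (A p)).
  - by rewrite inE permKV exc_v leqnn.
  - by rewrite eqA inE permKV -eqt exc_v leqnn.
  have rank (r : 'S_n) : ((r^-1)%g v < v)%N ->
      #|[set j in A r | (j < (r^-1)%g v)%N]| = side_count r ((r^-1)%g v).
    move=> lt_rv; rewrite /side_count permKV lt_rv; apply: eq_card => j.
    rewrite !inE; have [->|/(perm_val_neq r)] := eqVneq j ((r^-1)%g v).
      by rewrite permKV !ltnn andbF.
    by rewrite permKV; lia.
  by rewrite /= {2}eqA !rank ?eqc // -eqt.
have non_eq (v : 'I_n) : (v <= (p^-1)%g v)%N -> (p^-1)%g v = (q^-1)%g v.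
  have [k] := ubnP (n - v); elim: k v => // k IHk v lt_vk exc_v.
  have {}IHk (u : 'I_n) : (v < u)%N -> (u <= (p^-1)%g u)%N ->
      (p^-1)%g u = (q^-1)%g u.
    by move=> lt_vu; apply: IHk; have := ltn_ord u; lia.
  pose A r := [set j : 'I_n | ((r : 'S_n) j <= j)%N && (r j <= v)%N].
  have eqA : A p = A q.
    apply/setP => j; rewrite !inE leqNgt [X in _ = X && _]leqNgt -eqb -leqNgt.
    case: leqP => //= le_pj.
    rewrite leqNgt [RHS]leqNgt; congr (~~ _).
    apply/idP/idP => lt_v.
      by have := IHk (p j) lt_v; rewrite permK => /(_ le_pj) {1}->; rewrite permKV.
    have := IHk (q j) lt_v.
    rewrite leqNgt eqt -leqNgt permK leqNgt -eqb -leqNgt => /(_ le_pj) <-.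
    by rewrite permKV.
  apply: (@inv_code_inj _ (A p) v).
  - by rewrite inE permKV exc_v leqnn.
  - by rewrite eqA inE permKV leqnn leqNgt -eqt -leqNgt exc_v.
  have rank (r : 'S_n) : (v <= (r^-1)%g v)%N ->
      inv_code (A r) v ((r^-1)%g v) = side_count r ((r^-1)%g v).
    move=> le_rv; rewrite /side_count permKV ltnNge le_rv; apply: eq_card => j.
    rewrite !inE; have [->|/(perm_val_neq r)] := eqVneq j ((r^-1)%g v).
      by rewrite permKV !ltnn andbF.
    by rewrite permKV; lia.
  by rewrite {2}eqA !rank ?eqc // leqNgt -eqt -leqNgt.
apply: invg_inj; apply/permP => v.
by have [/exc_eq|/non_eq] := ltnP ((p^-1)%g v) v.
Qed.

Lemma bool_ivt (f : nat -> bool) a b : (a <= b)%N -> f a -> ~~ f b ->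
  exists2 j, (a <= j < b)%N & f j && ~~ f j.+1.
Proof.
elim: b => [|b IHb]; first by rewrite leqn0 => /eqP-> ->.
rewrite leq_eqVlt => /predU1P[-> ->//|lt_ab] fa nfb.
case: (boolP (f b)) => [fb|nf]; first by exists b; rewrite ?fb ?nfb //; lia.
by have [j le_j fj] := IHb lt_ab fa nf; exists j => //; lia.
Qed.

(** * The linear history *)

(* The contribution of the letter [p i] to 2_31. *)
Definition cross_count m (p : 'S_m.+1) (i : 'I_m.+1) : nat :=
  #|[set j : 'I_m | (i < j)%N && (nth_letter p j.+1 < p i < nth_letter p j)%N]|.

(** The guards discard the nonexistent descents before the first and after the last position. *)
Definition linear_letter m (p : 'S_m.+1) (v : 'I_m.+1) : history_letter :=
  let i := (p^-1)%g v in
  ((0 < i)%N && descent p i.-1, (i < m)%N && descent p i, cross_count p i).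

Lemma sum_bottoms m (p : 'S_m.+1) (F : nat -> int) :
  \sum_v ((linear_letter p v).1.1)%:B * F v =
  \sum_(j < m) (descent p j)%:B * F (nth_letter p j.+1).
Proof.
rewrite (sum_inv_perm p (fun i v => ((0 < i)%N && descent p i.-1)%:B * F v)).
rewrite big_ord_recl /= mul0r add0r; apply: eq_bigr => j _.
by rewrite -nth_letterE.
Qed.

Lemma sum_tops m (p : 'S_m.+1) (F : nat -> int) :
  \sum_v ((linear_letter p v).1.2)%:B * F v =
  \sum_(j < m) (descent p j)%:B * F (nth_letter p j).
Proof.
rewrite (sum_inv_perm p (fun i v => ((i < m)%N && descent p i)%:B * F v)).
rewrite big_ord_recr /= ltnn mul0r addr0; apply: eq_bigr => j _.
by rewrite ltn_ord -nth_letterE.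
Qed.

(** Descent by descent: if the top is at most [v], or the descent straddles [v], then the bottom is
    below [v]; the two cases exclude each other. *)
Lemma linear_history_in m (p : 'S_m.+1) :
  history (linear_letter p) \in histories m.+1 0.
Proof.
apply: history_in => [v|]; last first.
  transitivity (\sum_(j < m) (descent p j)%:B * 1).
    by rewrite -(sum_bottoms p (fun=> 1)); apply: eq_bigr => u _; rewrite mulr1.
  by rewrite -(sum_tops p (fun=> 1)); apply: eq_bigr => u _; rewrite mulr1.
rewrite cardsz permKV.
have -> : \sum_(u < m.+1) ((u <= v)%N && (linear_letter p u).1.2)%:B =
    \sum_(j < m) (descent p j)%:B * (nth_letter p j <= v)%N%:B.
  rewrite -(sum_tops p (fun u => (u <= v)%N%:B)); apply: eq_bigr => u _; lia.
have -> : \sum_(u < m.+1) ((u < v)%N && (linear_letter p u).1.1)%:B =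
    \sum_(j < m) (descent p j)%:B * (nth_letter p j.+1 < v)%N%:B.
  rewrite -(sum_bottoms p (fun u => (u < v)%N%:B)); apply: eq_bigr => u _; lia.
rewrite -big_split; apply: ler_sum => j _; rewrite /descent /=.
by case: ltnP; case: ltnP; lia.
Qed.

Lemma linear_letterE m (p : 'S_m.+1) (i : 'I_m.+1) :
  linear_letter p (p i) =
  ((0 < i)%N && descent p i.-1, (i < m)%N && descent p i, cross_count p i).
Proof. by rewrite /linear_letter permK. Qed.

(** The letter at position [k + 1] is common to both words, and its bottom flag tells whether a
    descent leads to it. *)
Lemma linear_letter_descent m (p q : 'S_m.+1) (k : 'I_m.+1) :
  linear_letter p =1 linear_letter q ->
  (forall j : 'I_m.+1, (k < j)%N -> p j = q j) ->
  (k < m)%N && descent p k = (k < m)%N && descent q k.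
Proof.
move=> eq_pq eq_suffix; case: ltnP => //= lt_km.
pose w : 'I_m.+1 := inord k.+1.
have w_val : w = k.+1 :> nat by rewrite inordK.
have := eq_pq (p w); rewrite {2}eq_suffix ?w_val // !linear_letterE.
by rewrite !w_val /= => -[].
Qed.

(* Reading from right to left, the next letter is forced: it is the smallest
   admissible top if a descent follows, and the largest admissible non-top
   otherwise.  Both [p k] and [q k] are admissible in either word. *)
Lemma linear_letter_step m (p q : 'S_m.+1) (k : 'I_m.+1) :
  linear_letter p =1 linear_letter q ->
  (forall j : 'I_m.+1, (k < j)%N -> p j = q j) -> p k != q k ->
  if (k < m)%N && descent p k then (p k < q k)%N else (q k < p k)%N.
Proof.
move=> eq_pq eq_suffix neq_pq.
have eqL j : (k < j <= m)%N -> nth_letter p j = nth_letter q j.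
  by move=> /andP[lt_kj le_jm]; rewrite /nth_letter eq_suffix // inordK.
set b := q k; set i := (p^-1)%g b.
have pi : p i = b by rewrite permKV.
have lt_ik : (i < k)%N.
  rewrite ltn_neqAle; apply/andP; split.
    by apply: contraNneq neq_pq => /val_inj E; rewrite -[q k]pi E.
  rewrite leqNgt; apply/negP => lt_ki; have := eq_suffix _ lt_ki.
  by rewrite pi => /perm_inj E; rewrite E ltnn in lt_ki.
have [eq_top eq_cross] : (linear_letter p b).1.2 = (linear_letter q b).1.2 /\
    (linear_letter p b).2 = (linear_letter q b).2 by rewrite eq_pq.
(* In [p] the letter [b] stands further left, yet its cross count is the same as in [q]. All
   descents after [k] are common, so none in between straddles [b]. *)
have no_cross (j : nat) : (i < j <= k)%N -> (j < m)%N ->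
    ~~ (nth_letter p j.+1 < b < nth_letter p j)%N.
  move=> /andP[lt_ij le_jk] lt_jm; apply/negP => cross_j.
  pose A (r : 'S_m.+1) (l : nat) := [set j : 'I_m |
    (l < j)%N && (nth_letter r j.+1 < b < nth_letter r j)%N].
  have sub : A q k \subset A p i.
    apply/subsetP => x; have := ltn_ord x; rewrite !inE => lt_xm /andP[lt_kx].
    by rewrite -!eqL ?(ltn_trans lt_ik lt_kx) //; lia.
  have : Ordinal lt_jm \in A p i by rewrite inE lt_ij.
  have /eqP <- : A q k == A p i.
    rewrite eqEcard sub /=; move: eq_cross.
    by rewrite -{1}pi !linear_letterE /= /cross_count pi => ->.
  by rewrite inE /= ltnNge le_jk.
have descent_eq := linear_letter_descent eq_pq eq_suffix.
have le_pk := nth_letterE p k; have le_qk := nth_letterE q k.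
have neq_val : (p k : nat) != b by rewrite (inj_eq val_inj).
case: ifP => [/andP[lt_km desc_k]|no_desc].
  have desc_q : descent q k by move: descent_eq; rewrite lt_km desc_k.
  have := no_cross k; rewrite lt_ik leqnn => /(_ isT lt_km).
  move: desc_k desc_q; rewrite /descent -eqL ?ltnSn // le_pk le_qk -/b; lia.
move: eq_top; rewrite -{1}pi !linear_letterE /= -descent_eq no_desc.
have lt_im : (i < m)%N by have := ltn_ord k; lia.
rewrite lt_im /descent nth_letterE pi => /negbT asc_i.
rewrite ltnNge; apply/negP => le_kb.
(* In [p] a larger letter follows [b]; were [p k] at most [b], the word would come down across [b]
   before [k]. *)
have [||j le_j /andP[gt_j le_j1]] :=
  @bool_ivt (fun j => (b < nth_letter p j)%N) i.+1 k lt_ik.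
- have := @nth_letter_neq m p i i.+1 (ltnW lt_im) lt_im.
  by rewrite nth_letterE pi; lia.
- by rewrite nth_letterE -leqNgt.
have lt_jm : (j < m)%N by have := ltn_ord k; lia.
have /negP[] := no_cross j ltac:(lia) lt_jm.
have := @nth_letter_neq m p i j.+1 (ltnW lt_im) lt_jm.
rewrite nth_letterE pi; lia.
Qed.

Lemma linear_letter_inj m (p q : 'S_m.+1) :
  linear_letter p =1 linear_letter q -> p = q.
Proof.
move=> eq_pq; apply/permP => k.
have [d] := ubnP (m - k); elim: d k => // d IHd k lt_d.
have suffix (j : 'I_m.+1) : (k < j)%N -> p j = q j.
  by move=> lt_kj; apply: IHd; have := ltn_ord j; lia.
apply/eqP; apply/negPn/negP => neq_pq.
have descent_eq := linear_letter_descent eq_pq suffix.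
have := linear_letter_step eq_pq suffix neq_pq.
have := linear_letter_step (fsym eq_pq) (fun j lt => esym (suffix j lt)).
by rewrite eq_sym neq_pq -descent_eq => /(_ isT); case: ifP; lia.
Qed.

(** * The last letter read off a history, and the transfer of the five statistics *)

Definition last_value m (x : 'I_m.+1 -> history_letter) (v : 'I_m.+1) : Prop :=
  [/\ ~~ (x v).1.2, (x v).2 = 0%N &
      forall u : 'I_m.+1, (v < u)%N -> ~~ (x u).1.2 -> (x u).2 != 0%N].

Lemma last_value_uniq m (x : 'I_m.+1 -> history_letter) v w :
  last_value x v -> last_value x w -> v = w.
Proof.
move=> [v_top v0 v_last] [w_top w0 w_last]; apply: val_inj.
have [lt_vw|lt_wv|//] := ltngtP v w.
  by have := v_last w lt_vw w_top; rewrite w0.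
by have := w_last v lt_wv v_top; rewrite v0.
Qed.

(** No position follows the last one, while a larger nonexcedance value has the last letter to its
    right and below it. *)
Lemma cyclic_last_value m (p : 'S_m.+1) :
  last_value (cyclic_letter p) (p ord_max).
Proof.
have le_max (i : 'I_m.+1) : (i <= (ord_max : 'I_m.+1))%N by rewrite -ltnS.
split=> [||u lt_u]; rewrite /= ?permK.
- by rewrite -leqNgt le_max.
- rewrite /side_count ltnNge le_max /=; apply: eq_card0 => j.
  by rewrite inE ltnNge le_max.
rewrite -leqNgt => le_u; rewrite /side_count permKV ltnNge le_u /= -lt0n.
apply/card_gt0P; exists ord_max; rewrite inE lt_u andbT.
have := le_max ((p^-1)%g u); rewrite leq_eqVlt => /predU1P[/val_inj E|//].
by move: lt_u; rewrite -E permKV ltnn.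
Qed.

(** A larger letter that is not a top is followed by an ascent, so the word must later descend
    across it to reach the last letter. *)
Lemma linear_last_value m (p : 'S_m.+1) :
  last_value (linear_letter p) (p ord_max).
Proof.
split=> [||u lt_u]; rewrite ?linear_letterE /= ?ltnn //.
  by apply: eq_card0 => j; rewrite inE ltnNge ltnW.
set i := (p^-1)%g u; have pi : p i = u by rewrite permKV.
have lt_im : (i < m)%N.
  have : (i <= m)%N by rewrite -ltnS.
  rewrite leq_eqVlt => /predU1P[E|//]; have iE : i = ord_max by apply: val_inj.
  by move: lt_u; rewrite -pi iE ltnn.
rewrite lt_im /descent nth_letterE pi => asc_i.
have [||j le_j /andP[gt_j le_j1]] :=
  @bool_ivt (fun j => (u < nth_letter p j)%N) i.+1 m lt_im.
- have := @nth_letter_neq m p i i.+1 (ltnW lt_im) lt_im.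
  by rewrite nth_letterE pi; lia.
- rewrite -leqNgt -[X in nth_letter p X]/(nat_of_ord (@ord_max m)) nth_letterE.
  exact: ltnW.
have lt_jm : (j < m)%N by lia.
rewrite -lt0n; apply/card_gt0P; exists (Ordinal lt_jm); rewrite inE /= pi.
have := @nth_letter_neq m p i j.+1 (ltnW lt_im) lt_jm.
rewrite nth_letterE pi; lia.
Qed.

(** [phi] matches histories: the bottom flags give [exc] and [ebot], both flags give [edif], the
    counts give [ine], and [last_value] gives the last letter. *)
Lemma linear_to_cyclic m :
  exists2 phi : 'S_m.+1 -> 'S_m.+1, injective phi & forall p,
    (exc (phi p) = des p) * (ebot (phi p) = dbot p) *
    (edif (phi p) = ddif p) * (ine (phi p) = pat2_31 p) *
    (last_letter (phi p) = last_letter p).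
Proof.
have size_h : size (histories m.+1 0) = m.+1`!.
  by rewrite size_histories bin0 muln1.
have inj_l : injective (fun p : 'S_m.+1 => history (linear_letter p)).
  by move=> p q /history_inj/linear_letter_inj.
have inj_c : injective (fun p : 'S_m.+1 => history (cyclic_letter p)).
  by move=> p q /history_inj/cyclic_letter_inj.
have [phi phi_inj eq_phi] := code_bijection inj_l inj_c
  (@linear_history_in m) (@cyclic_history_in m) size_h.
exists phi => // p; have {eq_phi} eq_x := history_inj (eq_phi p).
set q := phi p in eq_x *.
have bot (F : nat -> int) : \sum_(v < m.+1) (v < q v)%N%:B * F v =
    \sum_(j < m) (descent p j)%:B * F (nth_letter p j.+1).
  by rewrite -sum_bottoms; apply: eq_bigr => v _; rewrite eq_x.
have top (F : nat -> int) : \sum_(v < m.+1) (v < q v)%N%:B * F (q v) =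
    \sum_(j < m) (descent p j)%:B * F (nth_letter p j).
  rewrite -sum_tops -(sum_inv_perm q (fun v u => (v < u)%N%:B * F u)).
  by apply: eq_bigr => v _; rewrite eq_x.
split; [split; [split; [split|]|]|].
- rewrite excE desE.
  transitivity (\sum_(v < m.+1) (v < q v)%N%:B * 1).
    by apply: eq_bigr => v _; rewrite mulr1.
  by rewrite (bot (fun=> 1)); apply: eq_bigr => j _; rewrite mulr1.
- by rewrite ebotE dbotE (bot (fun v => v%:Z + 1)).
- rewrite edifE ddifE.
  transitivity (\sum_(v < m.+1) (v < q v)%N%:B * (q v)%:Z
    - \sum_(v < m.+1) (v < q v)%N%:B * v%:Z).
    by rewrite -sumrB; apply: eq_bigr => v _; rewrite mulrBr.
  rewrite (bot (fun v => v%:Z)) (top (fun v => v%:Z)) -sumrB.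
  by apply: eq_bigr => v _; rewrite mulrBr.
- rewrite /ine pat2_31E.
  transitivity (\sum_v (side_count q ((q^-1)%g v))%:Z).
    rewrite (sum_inv_perm q (fun i _ => (side_count q i)%:Z)).
    by apply: eq_bigr => i _; rewrite side_countE.
  transitivity (\sum_v (cross_count p ((p^-1)%g v))%:Z).
    apply: eq_bigr => v _; congr Posz.
    by rewrite -[LHS]/((cyclic_letter q v).2) -eq_x.
  rewrite (sum_inv_perm p (fun i _ => (cross_count p i)%:Z)).
  by apply: eq_bigr => i _; rewrite cardsz.
have last_p := linear_last_value p; have [q_top q0 q_last] := cyclic_last_value q.
rewrite !last_letterE; congr (_%:Z + 1); congr nat_of_ord.
apply: (@last_value_uniq m (linear_letter p)) last_p.
by split=> [||u]; rewrite eq_x //; apply: q_last.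
Qed.

(** * Transport of the Mahonian property along injections *)

Lemma mahonian_transport (st st' : statistic) :
  (forall m, exists f g : 'S_m.+1 -> 'S_m.+1,
    [/\ injective f, injective g & forall p, st _ (f p) = st' _ (g p)]) ->
  mahonian st' -> mahonian st.
Proof.
move=> fg mah' [//|m] m_gt0 k; have [f [g [f_inj g_inj eq_fg]]] := fg m.
rewrite -(mah' m.+1 m_gt0 k) -(card_preimset _ f_inj) -[RHS](card_preimset _ g_inj).
by apply: eq_card => p; rewrite !inE eq_fg.
Qed.

Lemma mahonian_comp (st st' : statistic) (f : forall m, 'S_m.+1 -> 'S_m.+1) :
  (forall m, injective (f m)) -> (forall m (p : 'S_m.+1), st _ p = st' _ (f m p)) ->
  mahonian st' -> mahonian st.
Proof.
move=> f_inj eq_f; apply: mahonian_transport => m; exists id, (f m).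
by split=> [p q||] //.
Qed.

Lemma mahonian_comp_inv (st st' : statistic) (f : forall m, 'S_m.+1 -> 'S_m.+1) :
  (forall m, injective (f m)) -> (forall m (p : 'S_m.+1), st _ (f m p) = st' _ p) ->
  mahonian st' -> mahonian st.
Proof.
move=> f_inj eq_f; apply: mahonian_transport => m; exists (f m), id.
by split=> [|p q|] //.
Qed.

Lemma inversions_complement n (p : 'S_n) :
  inversions (complement p) = half_int (n%:Z * (n%:Z - 1)) - inversions p.
Proof.
rewrite !inversionsE -sum_val.
have -> : \sum_(i < n) i%:Z = \sum_(i < n) \sum_(j < n) (i < j)%N%:B.
  rewrite exchange_big; apply: eq_bigr => j _ /=.
  by rewrite sum_lt // ltnW.
rewrite -sumrB; apply: eq_bigr => i _; rewrite -sumrB; apply: eq_bigr => j _.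
rewrite !complementE /=; have := ltn_ord (p i); have := ltn_ord (p j).
by have [->|/(perm_val_neq p)] := eqVneq i j; lia.
Qed.

(** Complementation makes the distribution of [inversions] symmetric. *)
Lemma mahonian_flip (st : statistic) :
  mahonian st ->
  mahonian (fun n p => half_int (n%:Z * (n%:Z - 1)) - st n p).
Proof.
move=> mah [//|m] m_gt0 k; set N := half_int _.
have -> : #|[set p : 'S_m.+1 | N - st _ p == k]| =
    #|[set p : 'S_m.+1 | st _ p == N - k]|.
  by apply: eq_card => p; rewrite !inE; lia.
rewrite mah //; have compl_inj : injective (@complement m.+1).
  move=> p q eq_c; apply/permP => i; apply: rev_ord_inj.
  by rewrite -!complementE eq_c.
rewrite -(card_preimset _ compl_inj); apply: eq_card => p.
by rewrite !inE inversions_complement -/N; lia.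
Qed.

(** * Reduction of all statistics to [inversions], [den] and [fz4] *)

Lemma fz3_shift_inverse m (p : 'S_m.+1) :
  fz3 p = half_int (m.+1%:Z * (m.+1%:Z - 1)) - den (shift_inverse p).
Proof.
rewrite /fz3 /den ebot_shift_inverse ine_shift_inverse; lia.
Qed.

Lemma fz3'_rev_compl_inverse m (p : 'S_m.+1) :
  fz3' p = half_int (m.+1%:Z * (m.+1%:Z - 1)) - den (rev_compl_inverse p).
Proof.
rewrite /fz3' /fz3 /den ebot_rev_compl_inverse ine_rev_compl_inverse; lia.
Qed.

Lemma den'_shift_inverse m (p : 'S_m.+1) :
  den' p = den (rev_compl_inverse (shift_inverse p)).
Proof.
rewrite /den' /den ebot_rev_compl_inverse ine_rev_compl_inverse.
rewrite exc_shift_inverse ebot_shift_inverse edif_shift_inverse ine_shift_inverse.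
rewrite half_n_n3 last_letterE.
have := half_n_n1K m.+1; nia.
Qed.

Lemma fz4'_shift_inverse m (p : 'S_m.+1) : fz4' p = fz4 (shift_inverse p).
Proof.
rewrite /fz4' /fz4 exc_shift_inverse edif_shift_inverse ine_shift_inverse.
rewrite last_letterE; lia.
Qed.

Lemma inv'_shift_inverse m (p : 'S_m.+1) : inv' p = inversions (shift_inverse p).
Proof. by rewrite /inv' inv_shift_inverse last_letterE; lia. Qed.

(** This and the next two identities show that the shifted statistics are the cyclic ones seen
    through rho. *)
Lemma vbot_shift_inverse m (p : 'S_m.+1) : vbot (shift_inverse p) = ebot p.
Proof.
rewrite vbotE ebot_shift_inverse edif_shift_inverse exc_shift_inverse; lia.
Qed.

Lemma vedif_shift_inverse m (p : 'S_m.+1) : vedif (shift_inverse p) = edif p.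
Proof.
rewrite vedifE edif_shift_inverse exc_shift_inverse pone_shift_inverse; lia.
Qed.

Lemma vnest_shift_inverse m (p : 'S_m.+1) : vnest (shift_inverse p) = ine p.
Proof.
rewrite vnestE ine_shift_inverse exc_shift_inverse pone_shift_inverse; lia.
Qed.

Definition shifted_cyclicE m (p : 'S_m.+1) :=
  (vbot_shift_inverse p, vedif_shift_inverse p, vnest_shift_inverse p,
   exc_shift_inverse p, pone_shift_inverse p).

Lemma yzl1_shift_inverse m (p : 'S_m.+1) : yzl1 (shift_inverse p) = den p.
Proof. by rewrite /yzl1 !shifted_cyclicE. Qed.

Lemma yzl2_shift_inverse m (p : 'S_m.+1) : yzl2 (shift_inverse p) = inversions p.
Proof. by rewrite /yzl2 !shifted_cyclicE inv_edif_ine. Qed.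

Lemma yzl3_shift_inverse m (p : 'S_m.+1) : yzl3 (shift_inverse p) = fz3 p.
Proof. by rewrite /yzl3 /fz3 !shifted_cyclicE; lia. Qed.

Lemma yzl4_shift_inverse m (p : 'S_m.+1) : yzl4 (shift_inverse p) = fz4 p.
Proof. by rewrite /yzl4 /fz4 !shifted_cyclicE; lia. Qed.

Lemma yzl1'_shift_inverse m (p : 'S_m.+1) : yzl1' (shift_inverse p) = den' p.
Proof.
rewrite /yzl1' yzl1_shift_inverse !shifted_cyclicE /den' half_n_n3 half_opp_n2.
rewrite last_letterE; have := half_n_n1K m.+1; nia.
Qed.

Lemma yzl2'_shift_inverse m (p : 'S_m.+1) : yzl2' (shift_inverse p) = inv' p.
Proof.
by rewrite /yzl2' yzl2_shift_inverse !shifted_cyclicE /inv' last_letterE; lia.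
Qed.

Lemma yzl3'_shift_inverse m (p : 'S_m.+1) : yzl3' (shift_inverse p) = fz3' p.
Proof.
rewrite /yzl3' yzl3_shift_inverse !shifted_cyclicE /fz3'.
have := half_n_n1K m.+1; nia.
Qed.

Lemma yzl4'_shift_inverse m (p : 'S_m.+1) : yzl4' (shift_inverse p) = fz4' p.
Proof.
by rewrite /yzl4' yzl4_shift_inverse !shifted_cyclicE /fz4' last_letterE; lia.
Qed.

Lemma mahonian_cyclic_linear (st st' : statistic) :
  (forall m (p q : 'S_m.+1), exc q = des p -> ebot q = dbot p ->
     edif q = ddif p -> ine q = pat2_31 p -> last_letter q = last_letter p ->
     st _ p = st' _ q) ->
  mahonian st' -> mahonian st.
Proof.
move=> eq_st; apply: mahonian_transport => m.
have [phi phi_inj eq_phi] := linear_to_cyclic m.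
by exists id, phi; split=> [p q||p] //; apply: eq_st; rewrite eq_phi.
Qed.

Lemma mahonian_inversions : mahonian inversions. Proof. by []. Qed.

Lemma mahonian_den : mahonian den.
Proof.
apply: mahonian_transport mahonian_inversions => m.
have [phi phi_inj eq_phi] := den_inv_bijection m.
by exists id, phi; split=> [p q||].
Qed.

(** On [phi p], [fz4] is [2 ddif - des - 2_31 = ddif + 31_2 = madl p]. This is [mad] of the
    reverse-complement, hence [edif + ine], that is [inversions], of its image under [phi]. *)
Lemma mahonian_fz4 : mahonian fz4.
Proof.
apply: mahonian_transport mahonian_inversions => m.
have [phi phi_inj eq_phi] := linear_to_cyclic m.
exists phi, (fun p => phi (rev_compl p)); split=> [//||p].
  exact: inj_comp phi_inj (@rev_compl_inj _).
rewrite inv_edif_ine /fz4 !eq_phi.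
have := mad_rev_compl p; have := ddif_patterns p; rewrite /mad /madl; lia.
Qed.

Theorem theorem4p20 :
  (mahonian mak' /\ mahonian mad' /\ mahonian makl' /\ mahonian madl' /\
   mahonian fz3 /\ mahonian fz4 /\
   mahonian inv' /\ mahonian den' /\ mahonian fz3' /\ mahonian fz4' /\
   mahonian yzl1 /\ mahonian yzl2 /\ mahonian yzl3 /\ mahonian yzl4 /\
   mahonian yzl1' /\ mahonian yzl2' /\ mahonian yzl3' /\ mahonian yzl4') /\
  (forall (n : nat) (pi : 'S_n), (0 < n)%N ->
     mad' pi = sist'' (complement pi) /\
     madl' pi = sist' (complement pi) /\
     makl' pi = makl (complement pi)).
Proof.
pose shift m := @shift_inverse m.+1; pose rci m := @rev_compl_inverse m.+1.
have shift_inj m : injective (shift m) := @shift_inverse_inj _.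
have rci_inj m : injective (rci m) := @rev_compl_inverse_inj _.
have mah_fz3 := mahonian_comp shift_inj fz3_shift_inverse
  (mahonian_flip mahonian_den).
have mah_fz3' := mahonian_comp rci_inj fz3'_rev_compl_inverse
  (mahonian_flip mahonian_den).
have mah_den' := mahonian_comp (fun m => inj_comp (rci_inj m) (shift_inj m))
  den'_shift_inverse mahonian_den.
have mah_fz4' := mahonian_comp shift_inj fz4'_shift_inverse mahonian_fz4.
have mah_inv' := mahonian_comp shift_inj inv'_shift_inverse mahonian_inversions.
split; last first.
  move=> [//|m] p _; split; [exact: mad'_complement|split].
    exact: madl'_complement.
  exact: makl'_complement.
(* The linear statistics [mak'], [mad'], [makl'], [madl'] correspond in turn to [den'], [inv'],
   [fz3'], [fz4']. *)
split.
  apply: mahonian_cyclic_linear mah_den' => m p q eq1 eq2 eq3 eq4 eq5.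
  by rewrite /den' /den eq1 eq2 eq4 eq5.
split.
  apply: mahonian_cyclic_linear mah_inv' => m p q eq1 eq2 eq3 eq4 eq5.
  by rewrite /inv' inv_edif_ine eq3 eq4 eq5 /mad' /mad; lia.
split.
  apply: mahonian_cyclic_linear mah_fz3' => m p q eq1 eq2 eq3 eq4 eq5.
  rewrite /fz3' /fz3 eq1 eq2 eq3 eq4 /makl' /makl.
  by have := ddif_patterns p; lia.
split.
  apply: mahonian_cyclic_linear mah_fz4' => m p q eq1 eq2 eq3 eq4 eq5.
  rewrite /fz4' /fz4 eq1 eq3 eq4 eq5 /madl' /madl.
  by have := ddif_patterns p; lia.
do 2!split=> //; first exact: mahonian_fz4.
do 4!split=> //.
split; first exact: mahonian_comp_inv shift_inj yzl1_shift_inverse mahonian_den.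
split.
  exact: mahonian_comp_inv shift_inj yzl2_shift_inverse mahonian_inversions.
split; first exact: mahonian_comp_inv shift_inj yzl3_shift_inverse mah_fz3.
split; first exact: mahonian_comp_inv shift_inj yzl4_shift_inverse mahonian_fz4.
split; first exact: mahonian_comp_inv shift_inj yzl1'_shift_inverse mah_den'.
split; first exact: mahonian_comp_inv shift_inj yzl2'_shift_inverse mah_inv'.
split; first exact: mahonian_comp_inv shift_inj yzl3'_shift_inverse mah_fz3'.
exact: mahonian_comp_inv shift_inj yzl4'_shift_inverse mah_fz4'.
Qed.
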